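(* Let $X$ be a Mackey complete, barrelled locally convex space and let $(T(t))_{t\geqslant 0}$ be an exponentially bounded $C_0$-semigroup on $X$. Then the following implications between stability properties of $(T(t))_{t\geqslant0}$ hold: (a) uniformly exponentially stable $\Rightarrow$ pseudo uniformly exponentially stable; (b) uniformly exponentially stable $\Rightarrow$ strongly exponentially stable; (c) pseudo uniformly exponentially stable $\Rightarrow$ pseudo strongly exponentially stable; (d) strongly exponentially stable $\Rightarrow$ pseudo strongly exponentially stable; (e) pseudo strongly exponentially stable $\Rightarrow$ super polynomially stable; (f) super polynomially stable $\Rightarrow$ uniformly stable; (g) uniformly stable $\Rightarrow$ strongly stable. None of the implications (a)--(g) is an equivalence: for each of them there exist a Mackey complete, barrelled locally convex space and an exponentially bounded $C_0$-semigroup on it which satisfies the conclusion but not the hypothesis of the implication. Moreover, between the two conditions ''pseudo uniformly exponentially stable'' and ''strongly exponentially stable'' no implication is true in general: there are exponentially bounded $C_0$-semigroups on Mackey complete, barrelled locally convex spaces which satisfy the first but not the second, and ones which satisfy the second but not the first.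
   Context: Locally convex spaces are assumed Hausdorff. For a locally convex space $X$, $\Gamma_X$ denotes a fundamental system of continuous seminorms determining the topology of $X$ (every element of $\Gamma_X$ is a continuous seminorm, and for each continuous seminorm $p$ on $X$ there are $q\in\Gamma_X$ and $C\geqslant0$ with $p\leqslant Cq$), $L(X)$ is the space of all continuous linear operators $X\to X$, and $\mathcal{B}_X$ is the collection of all bounded subsets of $X$. For $q\in\Gamma_X$, $B\in\mathcal{B}_X$ and $S\in L(X)$ put $q_B(S)=\sup_{x\in B}q(Sx)$. $X$ is barrelled if every absolutely convex, absorbing and closed set is a neighborhood of zero. A sequence $(x_n)_{n\in\mathbb{N}}$ in $X$ is Mackey Cauchy if there exist $B\in\mathcal{B}_X$ and scalars $b_{n,k}$ tending to zero as $n$ and $k$ both tend to infinity such that $x_n-x_k\in b_{n,k}B$ for all $n,k\in\mathbb{N}$; $X$ is Mackey complete if every Mackey Cauchy sequence in $X$ converges. A $C_0$-semigroup on $X$ is a family $(T(t))_{t\geqslant0}\subseteq L(X)$ with $T(0)=\mathrm{id}_X$, $T(s+t)=T(s)T(t)$ for all $s,t\geqslant0$, and $\lim_{t\to t_0}T(t)x=T(t_0)x$ for all $t_0\geqslant0$, $x\in X$. It is exponentially bounded if $\forall q\in\Gamma_X\ \exists p\in\Gamma_X, M\geqslant1,\omega\in\mathbb{R}\ \forall t\geqslant0, x\in X$: $q(T(t)x)\leqslant Me^{\omega t}p(x)$. A $C_0$-semigroup $(T(t))_{t\geqslant0}$ on $X$ is called - uniformly exponentially stable if $\exists\omega>0\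 \forall B\in\mathcal{B}_X, q\in\Gamma_X$: $\lim_{t\to\infty}q_B(e^{\omega t}T(t))=0$; - pseudo uniformly exponentially stable if $\forall q\in\Gamma_X\ \exists\omega>0\ \forall B\in\mathcal{B}_X$: $\lim_{t\to\infty}q_B(e^{\omega t}T(t))=0$; - strongly exponentially stable if $\forall x\in X\ \exists\omega>0$: $\lim_{t\to\infty}e^{\omega t}T(t)x=0$; - pseudo strongly exponentially stable if $\forall q\in\Gamma_X, x\in X\ \exists\omega>0$: $\lim_{t\to\infty}q(e^{\omega t}T(t)x)=0$; - super polynomially stable if $\forall\alpha>1, B\in\mathcal{B}_X, q\in\Gamma_X$: $\lim_{t\to\infty}q_B(t^{\alpha}T(t))=0$; - uniformly stable if $\forall B\in\mathcal{B}_X, q\in\Gamma_X$: $\lim_{t\to\infty}q_B(T(t))=0$; - strongly stable if $\forall x\in X$: $\lim_{t\to\infty}T(t)x=0$. *)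

(* Defs.v *)
From HB Require Import structures.
From mathcomp Require Import all_boot all_order all_algebra.
From mathcomp Require Import all_classical all_reals all_analysis.
From mathcomp.real_closed Require Import complex.

Set Implicit Arguments.
Unset Strict Implicit.
Unset Printing Implicit Defensive.

Import Order.TTheory GRing.Theory Num.Theory.
Import numFieldNormedType.Exports.

Local Open Scope classical_set_scope.
Local Open Scope ring_scope.

(* Spaces are over the real or over the complex scalars; the scalar field is   *)
(* selected by a tag so that both cases share the same definitions.            *)
Inductive scalar_kind := RealScalars | ComplexScalars.

Definition scalar_field (R : realType) (k : scalar_kind) : numFieldType :=
  match k with
  | RealScalars => R
  | ComplexScalars => R[i]
  end.

Definition of_real (R : realType) (k : scalar_kind) : R -> scalar_field R k :=
  match k with
  | RealScalars => fun r => r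
  | ComplexScalars => fun r => real_complex R r
  end.
Arguments of_real {R k}.

Section LocallyConvex.
Context (R : realType) (k : scalar_kind) (X : tvsType (scalar_field R k)).

(* Homogeneity is an equation between scalars because [`|a|] is an element of  *)
(* the scalar field, while seminorms take values in [R].                       *)
Definition seminorm (p : X -> R) : Prop :=
  [/\ forall x, 0 <= p x,
      forall x y, p (x + y) <= p x + p y
    & forall a x, of_real (p (a *: x)) = `|a| * of_real (p x)].

Definition fundamental_system (G : set (X -> R)) : Prop :=
  (forall q, G q -> seminorm q /\ continuous q) /\
  (forall p : X -> R, seminorm p -> continuous p ->
    exists q (C : R), [/\ G q, 0 <= C & forall x, p x <= C * q x]).

Definition continuous_operator (S : X -> X) : Prop := linear S /\ continuous S.

Definition absorbs (U B : set X) : Prop :=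
  exists2 r : scalar_field R k, 0 < r &
    forall a : scalar_field R k, r <= `|a| -> B `<=` [set a *: u | u in U].

Definition tvs_bounded (B : set X) : Prop :=
  forall U : set X, nbhs 0 U -> absorbs U B.

Definition absorbing (A : set X) : Prop := forall x, absorbs A [set x].

Definition absolutely_convex (A : set X) : Prop :=
  forall (x y : X) (a b : scalar_field R k),
    A x -> A y -> `|a| + `|b| <= 1 -> A (a *: x + b *: y).

Definition barrelled : Prop :=
  forall A : set X,
    absolutely_convex A -> absorbing A -> closed A -> nbhs 0 A.

Definition mackey_cauchy (x : nat -> X) : Prop :=
  exists (B : set X) (b : nat -> nat -> scalar_field R k),
    [/\ tvs_bounded B,
        b nm.1 nm.2 @[nm --> (\oo, \oo)] --> (0 : scalar_field R k)
      & forall n m, [set b n m *: u | u in B] (x n - x m)].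

Definition mackey_complete : Prop :=
  forall x : nat -> X, mackey_cauchy x -> exists l : X, x @ \oo --> l.

(* [q_B(S)]. The supremum is finite when [q] is a continuous seminorm, [B] is  *)
(* bounded and [S] is a continuous operator; it is 0 for empty [B].            *)
Definition op_seminorm (q : X -> R) (B : set X) (S : X -> X) : R :=
  sup [set q (S x) | x in B].

End LocallyConvex.

Record lcs (R : realType) (k : scalar_kind) := Lcs {
  lcs_space :> tvsType (scalar_field R k) ;
  lcs_hausdorff : hausdorff_space lcs_space ;
  Gamma : set (lcs_space -> R) ;
  lcs_fundamental : fundamental_system Gamma
}.
Arguments Gamma {R k} X _ : rename.

Section Semigroups.
Context (R : realType) (k : scalar_kind) (X : lcs R k).

(* Operator families indexed by [t >= 0] are functions on [R] whose values at  *)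
(* negative arguments are never referred to.                                   *)
Implicit Types T : R -> X -> X.

Definition C0_semigroup T : Prop :=
  [/\ forall t : R, 0 <= t -> continuous_operator (T t),
      forall x, T 0 x = x,
      forall s t : R, 0 <= s -> 0 <= t -> forall x, T (s + t) x = T s (T t x)
    & forall (t0 : R) x, 0 <= t0 ->
        T t x @[t --> within [set t : R | 0 <= t] (nbhs t0)] --> T t0 x].

Definition exponentially_bounded T : Prop :=
  forall q, Gamma X q -> exists p (M omega : R),
    [/\ Gamma X p, 1 <= M
      & forall t x, 0 <= t -> q (T t x) <= M * expR (omega * t) * p x].

Definition scale_family (c : R -> R) T : R -> X -> X :=
  fun t x => of_real (c t) *: T t x.

Definition uniformly_exponentially_stable T : Prop :=
  exists2 omega : R, 0 < omega &
    forall B q, tvs_bounded B -> Gamma X q ->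
      op_seminorm q B (scale_family (fun s => expR (omega * s)) T t)
        @[t --> +oo] --> (0 : R).

Definition pseudo_uniformly_exponentially_stable T : Prop :=
  forall q, Gamma X q -> exists2 omega : R, 0 < omega &
    forall B, tvs_bounded B ->
      op_seminorm q B (scale_family (fun s => expR (omega * s)) T t)
        @[t --> +oo] --> (0 : R).

Definition strongly_exponentially_stable T : Prop :=
  forall x, exists2 omega : R, 0 < omega &
    scale_family (fun s => expR (omega * s)) T t x @[t --> +oo] --> (0 : X).

Definition pseudo_strongly_exponentially_stable T : Prop :=
  forall q x, Gamma X q -> exists2 omega : R, 0 < omega &
    q (scale_family (fun s => expR (omega * s)) T t x)
      @[t --> +oo] --> (0 : R).

Definition super_polynomially_stable T : Prop :=
  forall (alpha : R) B q, 1 < alpha -> tvs_bounded B -> Gamma X q ->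
    op_seminorm q B (scale_family (fun s => s `^ alpha) T t)
      @[t --> +oo] --> (0 : R).

Definition uniformly_stable T : Prop :=
  forall B q, tvs_bounded B -> Gamma X q ->
    op_seminorm q B (T t) @[t --> +oo] --> (0 : R).

Definition strongly_stable T : Prop :=
  forall x, T t x @[t --> +oo] --> (0 : X).

Definition admissible T : Prop :=
  [/\ mackey_complete X, barrelled X, C0_semigroup T
    & exponentially_bounded T].

End Semigroups.

Arguments uniformly_exponentially_stable {R k} X T.
Arguments pseudo_uniformly_exponentially_stable {R k} X T.
Arguments strongly_exponentially_stable {R k} X T.
Arguments pseudo_strongly_exponentially_stable {R k} X T.
Arguments super_polynomially_stable {R k} X T.
Arguments uniformly_stable {R k} X T.
Arguments strongly_stable {R k} X T.

Definition realised_without (R : realType) (k : scalar_kind)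
    (P Q : forall X : lcs R k, (R -> X -> X) -> Prop) : Prop :=
  exists (X : lcs R k) (T : R -> X -> X), [/\ admissible T, P X T & ~ Q X T].
Arguments realised_without R k P Q : clear implicits.

(* Main.v *)
(* The only substantial implication is that pseudo strong exponential stability
   implies super polynomial stability. For a seminorm q of the fundamental system
   and a large n, the set {x | t^n q(T(t)x) <= 1 for all t >= 1} is a barrel:
   exponential boundedness controls compact time intervals, and e^(-omega t) beats
   t^n afterwards. Hence it is a neighbourhood of zero and absorbs bounded sets.

   All counterexamples are diagonal semigroups (T(t)x)_n = e^(-l_n t) x_n on Koethe
   spaces {x | w_n x_n -> 0 for every weight w}:
   - the full product, l_n = 1/(n+1): every seminorm sees finitely many coordinates,
     but the decay rate of a single vector may be zero;
   - the finitely supported sequences with the finest locally convex topology,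
     l_n = 1/(n+1): every vector has a rate, but a single seminorm sees all rates;
   - the rapidly decreasing sequences, where l_n = 1/(n+1) trades polynomial decay for
     polynomial weights, while with l_n = e^(-n) the decay is only logarithmic;
   - c_0 with l_n = 1/(n+1). *)
Require Import Defs.
From HB Require Import structures.
From mathcomp Require Import all_boot all_order all_algebra.
From mathcomp Require Import all_classical all_reals all_analysis.
From mathcomp Require Import lra ring.
From mathcomp.real_closed Require Import complex.

Set Implicit Arguments.
Unset Strict Implicit.
Unset Printing Implicit Defensive.

Import Order.TTheory GRing.Theory Num.Theory.
Import numFieldNormedType.Exports.

Local Open Scope classical_set_scope.
Local Open Scope ring_scope.

(** * Scalars *)

Section Scalars.
Context (R : realType) (k : scalar_kind).
Local Notation K := (scalar_field R k).

(** The modulus as a real number. Seminorms and all estimates below live in [R], whose order is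
    total, while the order of the complex field is only partial. *)
Definition absR : K -> R :=
  match k return scalar_field R k -> R with
  | RealScalars => fun a => `|a|
  | ComplexScalars => fun a : R[i] => complex.Re `|a|
  end.

Lemma of_realD (r s : R) : of_real (r + s) = of_real r + of_real s :> K.
Proof. by case: k => //=; exact: rmorphD. Qed.

Lemma of_realM (r s : R) : of_real (r * s) = of_real r * of_real s :> K.
Proof. by case: k => //=; exact: rmorphM. Qed.

Lemma of_real0 : of_real 0 = 0 :> K.
Proof. by case: k. Qed.

Lemma of_real1 : of_real 1 = 1 :> K.
Proof. by case: k. Qed.

Lemma of_realN (r : R) : of_real (- r) = - of_real r :> K.
Proof. by apply/eqP; rewrite -addr_eq0 -of_realD addNr of_real0. Qed.

Lemma ler_of_real (r s : R) : (of_real r <= of_real s :> K) = (r <= s).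
Proof. by case: k => //=; rewrite lecR. Qed.

Lemma of_real_inj : injective (of_real : R -> K).
Proof. by move=> r s /eqP; rewrite eq_le !ler_of_real -eq_le => /eqP. Qed.

Lemma of_real_eq0 (r : R) : (of_real r == 0 :> K) = (r == 0).
Proof. by rewrite -of_real0 (inj_eq of_real_inj). Qed.

Lemma ltr_of_real (r s : R) : (of_real r < of_real s :> K) = (r < s).
Proof. by rewrite !lt_neqAle ler_of_real (inj_eq of_real_inj). Qed.

Lemma of_real_norm (r : R) : of_real `|r| = `|of_real r| :> K.
Proof.
by case: k => //=; rewrite normc_def /= expr0n /= addr0 sqrtr_sqr.
Qed.

Lemma absRE a : of_real (absR a) = `|a|.
Proof. by rewrite /absR; case: k a => //= a; rewrite RRe_real ?normr_real. Qed.

Lemma absR_ge0 a : 0 <= absR a.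
Proof. by rewrite -ler_of_real absRE of_real0. Qed.

Lemma absR_gt0 a : (0 < absR a) = (a != 0).
Proof. by rewrite -ltr_of_real absRE of_real0 normr_gt0. Qed.

Lemma absRM a b : absR (a * b) = absR a * absR b.
Proof. by apply: of_real_inj; rewrite of_realM !absRE normrM. Qed.

Lemma absRD a b : absR (a + b) <= absR a + absR b.
Proof. by rewrite -ler_of_real of_realD !absRE ler_normD. Qed.

Lemma absRN a : absR (- a) = absR a.
Proof. by apply: of_real_inj; rewrite !absRE normrN. Qed.

Lemma absR0 : absR 0 = 0.
Proof. by apply: of_real_inj; rewrite absRE normr0 of_real0. Qed.

Lemma absR0_eq0 a : absR a = 0 -> a = 0.
Proof. by move=> a0; apply/eqP; rewrite -normr_eq0 -absRE a0 of_real0. Qed.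

Lemma absR_of_real r : absR (of_real r) = `|r|.
Proof. by apply: of_real_inj; rewrite absRE of_real_norm. Qed.

Lemma absR1 : absR 1 = 1.
Proof. by rewrite -of_real1 absR_of_real normr1. Qed.

Lemma absRV a : absR a^-1 = (absR a)^-1.
Proof.
have [->|a0] := eqVneq a 0; first by rewrite invr0 absR0 invr0.
have a1 : absR a != 0 by rewrite gt_eqF// absR_gt0.
by apply: (mulfI a1); rewrite -absRM !divff // absR1.
Qed.

Lemma absR_dist a b : absR (a - b) = absR (b - a).
Proof. by rewrite -opprB absRN. Qed.

Lemma gt0_of_real (e : K) : 0 < e -> exists2 r : R, 0 < r & of_real r = e.
Proof.
move=> e0; have eE : of_real (absR e) = e by rewrite absRE gtr0_norm.
by exists (absR e) => //; rewrite -ltr_of_real eE of_real0.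
Qed.

Lemma nbhs_absR (a : K) (U : set K) :
  nbhs a U <-> exists2 e : R, 0 < e & forall b, absR (a - b) < e -> U b.
Proof.
rewrite -nbhs_ballE; split => [[e /= /gt0_of_real[r r0 <-] aU]|[e e0 aU]].
  exists r => // b ab; apply: aU.
  by rewrite -ball_normE /= -absRE ltr_of_real.
exists (of_real e); first by rewrite /= -of_real0 ltr_of_real.
by move=> b; rewrite -ball_normE /= -absRE ltr_of_real; exact: aU.
Qed.

(** The complex case reduces to the real one through the two inequalities comparing the modulus of z
    with those of its real and imaginary parts. *)
Lemma absR_complete (u : nat -> K) :
  (forall e : R, 0 < e -> exists N, forall m n,
     (N <= m)%N -> (N <= n)%N -> absR (u m - u n) <= e) ->
  exists l : K, forall e : R, 0 < e -> exists N, forall n,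
    (N <= n)%N -> absR (u n - l) <= e.
Proof.
have realc (v : nat -> R) :
    (forall e : R, 0 < e -> exists N, forall m n,
       (N <= m)%N -> (N <= n)%N -> `|v m - v n| <= e) ->
    exists l : R, forall e : R, 0 < e -> exists N, forall n,
      (N <= n)%N -> `|v n - l| <= e.
  move=> cv; have vl : cvg (v @ \oo).
    apply: cauchy_cvg; apply: cauchy_exP => e e0.
    have [N vN] := cv _ (divr_gt0 e0 (@ltr0n R 2)).
    exists (v N), N => //= n Nn; rewrite -ball_normE /=.
    by apply: le_lt_trans (vN _ _ (leqnn N) Nn) _; rewrite ltr_pdivrMr ?ltr_pMr ?ltr1n.
  exists (lim (v @ \oo)) => e e0.
  have /cvgrPdist_le/(_ _ e0) [N _ vN] := vl.
  by exists N => n Nn; rewrite distrC; exact: vN.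
rewrite /absR; case: k u => /= u cu; first exact: realc.
have leRe (z : R[i]) : `|complex.Re z| <= complex.Re `|z|.
  by rewrite -lecR RRe_real ?normr_real// normc_ge_Re.
have leIm (z : R[i]) : `|complex.Im z| <= complex.Re `|z|.
  (* The imaginary part of z is minus the real part of iz, and multiplication by i preserves the
     modulus. *)
  rewrite -[complex.Im z]opprK -ReiNIm normrN.
  by apply: le_trans (leRe _) _; rewrite normrM (_ : `|'i%C| = 1) ?mulr1// normc_def /=
    expr0n expr1n add0r sqrtr1.
have leReIm (z : R[i]) : complex.Re `|z| <= `|complex.Re z| + `|complex.Im z|.
  rewrite -lecR RRe_real ?normr_real// normc_def lecR.
  rewrite -[leRHS]ger0_norm ?addr_ge0// -sqrtr_sqr ler_sqrt ?sqr_ge0// sqrrD.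
  by rewrite !real_normK ?num_real// lerD2r lerDl mulrn_wge0// mulr_ge0.
have [|a ua] := realc (fun n => complex.Re (u n)).
  move=> e /cu[N uN]; exists N => m n Nm Nn.
  by rewrite -raddfB; exact: le_trans (leRe _) (uN _ _ Nm Nn).
have [|b ub] := realc (fun n => complex.Im (u n)).
  move=> e /cu[N uN]; exists N => m n Nm Nn.
  by rewrite -raddfB; exact: le_trans (leIm _) (uN _ _ Nm Nn).
exists (a +i* b)%C => e e0.
have e2 : 0 < e / 2 by rewrite divr_gt0.
have [[M uM] [N uN]] := (ua _ e2, ub _ e2).
exists (maxn M N) => n; rewrite geq_max => /andP[Mn Nn].
apply: le_trans (leReIm _) _; rewrite [leRHS]splitr lerD// !raddfB/=.
  exact: uM.
exact: uN.
Qed.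

End Scalars.

(** * Seminorms and neighbourhoods of the origin *)

Section Seminorms.
Context (R : realType) (k : scalar_kind) (X : tvsType (scalar_field R k)).
Local Notation K := (scalar_field R k).
Implicit Types (p q : X -> R) (U : set X).

Lemma seminormZ p a x : seminorm p -> p (a *: x) = absR a * p x.
Proof. by case=> _ _ pZ; apply: (@of_real_inj _ k); rewrite pZ of_realM absRE. Qed.

Lemma seminormP p : (forall x, 0 <= p x) ->
  (forall x y, p (x + y) <= p x + p y) ->
  (forall a x, p (a *: x) = absR a * p x) -> seminorm p.
Proof. by move=> p0 pD pZ; split => // a x; rewrite pZ of_realM absRE. Qed.

Lemma seminorm0 p : seminorm p -> p 0 = 0.
Proof. by move=> sp; rewrite -(scale0r 0) seminormZ// absR0 mul0r. Qed.

Lemma seminormN p x : seminorm p -> p (- x) = p x.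
Proof. by move=> sp; rewrite -scaleN1r seminormZ// absRN absR1 mul1r. Qed.

Lemma seminormB p x y : seminorm p -> `|p x - p y| <= p (x - y).
Proof.
move=> sp; have [_ pD _] := sp.
have le u v : p u - p v <= p (u - v) by rewrite lerBlDr -{1}(subrK v u) pD.
by rewrite ler_norml le andbT lerNl opprB -(seminormN (x - y) sp) opprB le.
Qed.

Lemma continuous_seminorm p : seminorm p -> nbhs 0 [set x | p x < 1] -> continuous p.
Proof.
move=> sp p1 x; apply/cvgrPdist_le => /= e e0.
have e1 : of_real e != 0 :> K by rewrite of_real_eq0 gt_eqF.
have := nbhsT x (nbhs0Z e1 p1); apply: filterS => y [z [t /= pt <-] <-].
apply: le_trans (seminormB _ _ sp) _.
rewrite opprD addNKr seminormN// seminormZ// absR_of_real gtr0_norm//.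
by rewrite ger_pMr// ltW.
Qed.

Lemma nbhs_seminorm p (e : R) : continuous p -> seminorm p -> 0 < e ->
  nbhs 0 [set x | p x < e].
Proof.
move=> cp sp e0; have /cvgrPdist_lt/(_ _ e0) := cp 0.
apply: filterS => x /=; rewrite seminorm0// sub0r normrN.
exact: le_lt_trans (ler_norm _).
Qed.

(** V collects the points whose multiples by all scalars of modulus at most 1 stay in a convex
    neighbourhood C inside U. It inherits convexity from C, and it is a neighbourhood because scalar
    multiplication is continuous at (0, 0). *)
Lemma balanced_core U : nbhs 0 U -> exists V : set X,
  [/\ nbhs 0 V, V `<=` U,
      forall (a : K) x, absR a <= 1 -> V x -> V (a *: x)
    & forall x y (s : R), 0 <= s <= 1 -> V x -> V y ->
      V (of_real s *: x + of_real (1 - s) *: y)].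
Proof.
have [B Bconv [Bopen Bbase]] := @locally_convex K X.
move=> /Bbase [C [BC C0] CU].
exists [set x | forall a : K, absR a <= 1 -> C (a *: x)]; split.
- have := @scale_continuous K X (0, 0) C.
  rewrite /= scaler0 => /(_ (open_nbhs_nbhs (conj (Bopen _ BC) C0))).
  move=> [[W V] /= [/nbhs_absR [e e0 We] V0] WV].
  have e1 : of_real (e / 2) != 0 :> K.
    by rewrite of_real_eq0 gt_eqF// divr_gt0.
  apply: filterS (nbhs0Z e1 V0) => _ [x Vx <-] a a1.
  rewrite scalerA; apply: (WV (_, _)); split => //=; apply: We.
  rewrite sub0r absRN absRM absR_of_real gtr0_norm ?divr_gt0//.
  apply: le_lt_trans (ler_wpM2r _ a1) _; first by rewrite divr_ge0// ltW.
  by rewrite mul1r ltr_pdivrMr// ltr_pMr// ltr1n.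
- move=> x Cx; apply: CU; rewrite -(scale1r x); apply: Cx.
  by rewrite absR1.
- move=> a x a1 Cx b b1; rewrite scalerA; apply: Cx.
  by rewrite absRM mulr_ile1// ?absR_ge0.
- move=> x y s /andP[s0 s1] Cx Cy a a1.
  have s0' : 0 <= of_real s :> K by rewrite -of_real0 ler_of_real.
  have s1' : of_real s <= 1 :> K by rewrite -of_real1 ler_of_real.
  have := Bconv _ (mem_set BC) (a *: x) (a *: y) (Itv01 s0' s1').
  rewrite !inE => /(_ (Cx _ a1) (Cy _ a1)).
  by rewrite /conv/= scalerDr !scalerA ![a * _]mulrC of_realD of_real1 of_realN.
Qed.

(* The Minkowski functional of the balanced core of a convex neighbourhood. *)
Lemma seminorm_of_nbhs U : nbhs 0 U ->
  exists p, [/\ seminorm p, continuous p & [set x | p x < 1] `<=` U].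
Proof.
move=> /balanced_core[V [V0 VU Vbal Vconv]].
(* [G x] is the set of t > 0 with x in tV; the seminorm will be its infimum. *)
pose G x := [set t : R | 0 < t /\ V (of_real t^-1 *: x)].
have Vx0 x : exists2 e : R, 0 < e & V (of_real e *: x).
  have := @scale_continuous K X (0, x) V.
  rewrite /= scale0r => /(_ V0) [[W Z] /= [/nbhs_absR [e e0 We] Zx] WV].
  exists (e / 2); first by rewrite divr_gt0.
  apply: (WV (_, _)); split => /=; last exact: nbhs_singleton.
  apply: We; rewrite sub0r absRN absR_of_real gtr0_norm ?divr_gt0//.
  by rewrite ltr_pdivrMr// ltr_pMr// ltr1n.
have G0 x : G x !=set0.
  by have [e e0 Ve] := Vx0 x; exists e^-1; split; rewrite ?invr_gt0 ?invrK.
have Glb x : has_lbound (G x) by exists 0 => t [/ltW].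
have Gup x s t : G x s -> s <= t -> G x t.
  move=> [s0 Vs] st; have t0 := lt_le_trans s0 st; split => //.
  rewrite (_ : of_real t^-1 = of_real (s / t) * of_real s^-1); last first.
    by rewrite -of_realM mulrAC divff ?gt_eqF// mul1r.
  rewrite -scalerA; apply: Vbal => //.
  by rewrite absR_of_real ger0_norm ?divr_ge0 ?(ltW s0) ?(ltW t0)// ler_pdivrMr// mul1r.
(* (x + y) / (s + t) is the convex combination of x / s and y / t with weights s / (s + t) and t /
   (s + t). *)
have GD x y s t : G x s -> G y t -> G (x + y) (s + t).
  move=> [s0 Vs] [t0 Vt]; have st := addr_gt0 s0 t0; split => //.
  have := Vconv _ _ (s / (s + t)) _ Vs Vt; rewrite !scalerA -!of_realM.
  rewrite (_ : s / (s + t) / s = (s + t)^-1); last by field; rewrite !gt_eqF.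
  rewrite (_ : (1 - s / (s + t)) / t = (s + t)^-1); last by field; rewrite !gt_eqF.
  rewrite -scalerDr; apply.
  by rewrite divr_ge0 ?(ltW s0) ?(ltW st)//= ler_pdivrMr// mul1r lerDl ltW.
have GZ x a t : a != 0 -> G x t -> G (a *: x) (absR a * t).
  move=> a0 [t0 Vt].
  have a1 : 0 < absR a by rewrite absR_gt0.
  split; first exact: mulr_gt0.
  rewrite (_ : of_real _ *: _ = (a * of_real (absR a)^-1) *: (of_real t^-1 *: x)).
    apply: Vbal => //.
    by rewrite absRM absR_of_real gtr0_norm ?invr_gt0// divff ?gt_eqF.
  by rewrite !scalerA invfM of_realM mulrC mulrA.
pose p x := inf (G x).
have p0 x : 0 <= p x by apply: lb_le_inf => // t [/ltW].
have pz : p 0 = 0.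
  apply/eqP; rewrite eq_le p0 andbT; apply/ler_addgt0Pr => e e0; rewrite add0r.
  by apply: ge_inf => //; split => //; rewrite scaler0; exact: nbhs_singleton.
have pD x y : p (x + y) <= p x + p y.
  apply/ler_addgt0Pr => e e0; have e2 : 0 < e / 2 by rewrite divr_gt0.
  have [s Gs sx] := inf_adherent e2 (conj (G0 x) (Glb x)).
  have [t Gt ty] := inf_adherent e2 (conj (G0 y) (Glb y)).
  apply: (@le_trans _ _ (s + t)); first by apply: ge_inf => //; exact: GD.
  by rewrite (splitr e) addrACA lerD// ltW.
have pZle a x : p (a *: x) <= absR a * p x.
  have [->|a0] := eqVneq a 0; first by rewrite scale0r pz absR0 mul0r.
  have a1 : 0 < absR a by rewrite absR_gt0.
  rewrite -ler_pdivrMl//; apply: lb_le_inf => // t Gt.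
  by rewrite ler_pdivrMl//; apply: ge_inf => //; exact: GZ.
have sp : seminorm p.
  apply: seminormP => // a x; apply/eqP; rewrite eq_le pZle/=.
  have [->|a0] := eqVneq a 0; first by rewrite absR0 mul0r.
  have a1 : 0 < absR a by rewrite absR_gt0.
  (* The reverse inequality is [pZle] applied to the inverse of a and to the vector ax. *)
  by rewrite mulrC -ler_pdivlMr// mulrC -absRV -{1}(scalerK a0 x).
have pV x : V x -> p x <= 1.
  by move=> Vx; apply: ge_inf => //; split; rewrite // invr1 of_real1 scale1r.
have h0 : of_real 2^-1 != 0 :> K.
  by rewrite of_real_eq0 gt_eqF// invr_gt0.
exists p; split => //.
- apply: continuous_seminorm => //; apply: filterS (nbhs0Z h0 V0) => _ [x Vx <-].
  rewrite /= seminormZ// absR_of_real gtr0_norm ?invr_gt0// mulrC.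
  by rewrite ltr_pdivrMr// mul1r (le_lt_trans (pV _ Vx))// ltr1n.
- move=> x /= px; apply: VU.
  have [t /Gup Gt t1] := inf_lt (G0 x) px.
  by have [_] := Gt _ (ltW t1); rewrite invr1 of_real1 scale1r.
Qed.

(** Boundedness of singletons turns each uniform stability property into its strong counterpart. *)
Lemma tvs_bounded1 (x : X) : tvs_bounded [set x].
Proof.
move=> U U0; have := @scale_continuous K X (0, x) U.
rewrite /= scale0r => /(_ U0) [[W Z] /= [/nbhs_absR [e e0 We] Zx] WV].
have ei : 0 < (e / 2)^-1 by rewrite invr_gt0 divr_gt0.
exists (of_real (e / 2)^-1); first by rewrite -of_real0 ltr_of_real.
move=> a; rewrite -absRE ler_of_real => ae _ ->.
have a0 : a != 0.
  by apply: contraTneq ae => ->; rewrite absR0 -ltNge.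
exists (a^-1 *: x); last by rewrite scalerA divff// scale1r.
apply: (WV (_, _)); split => /=; last exact: nbhs_singleton.
apply: We; rewrite sub0r absRN absRV (@le_lt_trans _ _ (e / 2))//.
  by rewrite -[leRHS]invrK lef_pV2// posrE// (lt_le_trans ei).
by rewrite ltr_pdivrMr// ltr_pMr// ltr1n.
Qed.

Lemma bounded_seminorm B p : tvs_bounded B -> seminorm p -> continuous p ->
  exists2 C : R, 0 <= C & forall x, B x -> p x <= C.
Proof.
move=> Bb sp cp; have [_ /gt0_of_real[r r0 <-]] := Bb _ (nbhs_seminorm cp sp ltr01).
move=> /(_ (of_real r)); rewrite gtr0_norm -?of_real0 ?ltr_of_real// => /(_ (lexx _)) Br.
exists r; first exact: ltW.
move=> x /Br[u /= u1 <-]; rewrite seminormZ// absR_of_real gtr0_norm//.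
by rewrite ger_pMr// ltW.
Qed.

End Seminorms.

(** * Convergence to zero tested on the fundamental system *)

Section LcsTopology.
Context (R : realType) (k : scalar_kind) (X : lcs R k).

Lemma Gamma_seminorm (q : X -> R) : Gamma X q -> seminorm q.
Proof. by case: (lcs_fundamental X) => + _ => /[apply] -[]. Qed.

Lemma Gamma_continuous (q : X -> R) : Gamma X q -> continuous q.
Proof. by case: (lcs_fundamental X) => + _ => /[apply] -[]. Qed.

Lemma nbhs0_Gamma (U : set X) : nbhs 0 U ->
  exists (q : X -> R) (e : R), [/\ Gamma X q, 0 < e & [set x | q x < e] `<=` U].
Proof.
move=> /seminorm_of_nbhs[p [sp cp pU]].
have [_ /(_ _ sp cp)[q [C [Gq C0 pC]]]] := lcs_fundamental X.
(* C may be 0, so C + 1 is inverted. *)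
exists q, (C + 1)^-1; split => //; first by rewrite invr_gt0 ltr_wpDl.
have C1 : 0 < C + 1 by rewrite ltr_wpDl.
move=> x /= qx; apply: pU; apply: le_lt_trans (pC x) _.
have [q0 _ _] := Gamma_seminorm Gq.
apply: (@le_lt_trans _ _ ((C + 1) * q x)); first by rewrite ler_wpM2r// lerDl.
by rewrite mulrC -ltr_pdivlMr// mul1r.
Qed.

Lemma cvg0_Gamma (T : Type) (F : set_system T) (FF : Filter F) (f : T -> X) :
  (forall q : X -> R, Gamma X q -> q (f t) @[t --> F] --> (0 : R)) -> f @ F --> (0 : X).
Proof.
move=> fq U /nbhs0_Gamma [q [e [Gq e0 qU]]].
have /cvgrPdist_lt/(_ _ e0) := fq _ Gq.
apply: filterS => t; rewrite sub0r normrN => qt; apply: qU.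
exact: le_lt_trans (ler_norm _) qt.
Qed.

Lemma cvg_Gamma0 (T : Type) (F : set_system T) (FF : Filter F) (f : T -> X) (q : X -> R) :
  Gamma X q -> f @ F --> (0 : X) -> q (f t) @[t --> F] --> (0 : R).
Proof.
move=> Gq f0; rewrite -(seminorm0 (Gamma_seminorm Gq)).
by apply: continuous_cvg => //; exact: Gamma_continuous.
Qed.

End LcsTopology.

(** * The implications *)

(** With d = (n + 1) / w, raise t / d <= exp(t / d) to the n-th power and use n / d <= w. Taking n +
    1 instead of n keeps d positive for n = 0. *)
Lemma expR_ge_exprn (R : realType) (w : R) n : 0 < w ->
  exists2 C : R, 0 < C & forall t, 0 <= t -> t ^+ n <= C * expR (w * t).
Proof.
move=> w0; have [d d0 dw] : exists2 d, 0 < d & w * d = n.+1%:R.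
  by exists (n.+1%:R / w); [rewrite divr_gt0|rewrite mulrC divfK// gt_eqF].
exists (d ^+ n); first exact: exprn_gt0.
move=> t t0; apply: (@le_trans _ _ ((d * expR (t / d)) ^+ n)).
  apply: lerXn2r; rewrite ?nnegrE ?mulr_ge0 ?expR_ge0 ?(ltW d0)// -ler_pdivrMl//.
  by rewrite mulrC (le_trans _ (expR_ge1Dx _))// lerDr.
rewrite exprMn ler_wpM2l ?exprn_ge0 ?(ltW d0)// -expRM_natl ler_expR.
rewrite mulrCA mulrC ler_wpM2r// ler_pdivrMr// dw.
by rewrite ler_nat.
Qed.

Lemma mulr_powR_le (R : realType) (alpha t : R) n : 1 <= t -> alpha + 1 <= n%:R ->
  t * t `^ alpha <= t ^+ n.
Proof.
move=> t1 alphan; have t0 : 0 < t by exact: lt_le_trans t1.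
rewrite -[X in X * _]powRr1 ?(ltW t0)// -powRD ?(gt_eqF t0) ?implybT// -powR_mulrn ?(ltW t0)//.
by rewrite ler_powR// addrC.
Qed.

(** * Handling the supremum over a bounded set *)

Section OpSeminorm.
Context (R : realType) (k : scalar_kind) (X : tvsType (scalar_field R k)).
Implicit Types (q : X -> R) (B : set X) (S : X -> X).

Lemma op_seminorm1 q x S : op_seminorm q [set x] S = q (S x).
Proof. by rewrite /op_seminorm image_set1 sup1. Qed.

(** The sign condition on c covers the empty set, whose supremum is 0 by convention. *)
Lemma op_seminorm_le q B S (c : R) : 0 <= c ->
  (forall x, B x -> q (S x) <= c) -> op_seminorm q B S <= c.
Proof.
move=> c0 Bc; rewrite /op_seminorm; have [->|/set0P[x Bx]] := eqVneq B set0.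
  by rewrite image_set0 sup0.
apply: ge_sup; first by exists (q (S x)), x.
by move=> _ [y By <-]; exact: Bc.
Qed.

Lemma op_seminorm_ge0 q B S : (forall x, 0 <= q x) -> 0 <= op_seminorm q B S.
Proof.
move=> q0; rewrite /op_seminorm.
(* A set without a supremum gets the default value 0, which is harmless here. *)
have [hs|hs] := pselect (has_sup [set q (S x) | x in B]); last by rewrite sup_out.
have [[_ [x Bx _]] Bub] := hs.
by apply: le_trans (q0 (S x)) _; apply: ub_le_sup => //; exists x.
Qed.

Lemma op_seminorm_ge q B S (c : R) x : (forall y, B y -> q (S y) <= c) -> B x ->
  q (S x) <= op_seminorm q B S.
Proof.
move=> Bc Bx; apply: ub_le_sup; last by exists x.
by exists c => _ [y By <-]; exact: Bc.
Qed.

Lemma op_seminorm_cvg0 q B (F : R -> X -> X) (f : R -> R) :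
  (forall x, 0 <= q x) -> f t @[t --> +oo] --> (0 : R) ->
  (\forall t \near +oo, forall x, B x -> q (F t x) <= f t) ->
  op_seminorm q B (F t) @[t --> +oo] --> (0 : R).
Proof.
move=> q0 /cvgrPdist_le f0 Ff; apply/cvgrPdist_le => e /f0 fe.
near=> t; rewrite sub0r normrN ger0_norm; last exact: op_seminorm_ge0.
have ft : `|0 - f t| <= e by near: t.
apply: le_trans ft; rewrite sub0r normrN; apply: op_seminorm_le => // x Bx.
by apply: le_trans (ler_norm _); move: x Bx; near: t.
Unshelve. all: by end_near. Qed.

Lemma operator_seminorm q S : continuous_operator S -> seminorm q -> continuous q ->
  seminorm (q \o S) /\ continuous (q \o S).
Proof.
move=> [Slin Scont] sq cq.
have SZ a x : S (a *: x) = a *: S x.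
  have S0 : S 0 = 0 by apply: (addrI (S 0)); rewrite addr0 -{1}(scale1r (S 0)) -Slin scaler0 addr0.
  by rewrite -(addr0 (a *: x)) Slin S0 addr0.
split; last by move=> x; apply: continuous_comp; [exact: Scont|exact: cq].
have [q0 qD _] := sq; apply: seminormP => [x|x y|a x] /=; first exact: q0.
  by rewrite -{1}(scale1r x) Slin scale1r qD.
by rewrite SZ seminormZ.
Qed.

End OpSeminorm.

Section Implications.
Context (R : realType) (k : scalar_kind) (X : lcs R k) (T : R -> X -> X).

Lemma scale_family_seminorm (c : R -> R) (q : X -> R) t x : seminorm q ->
  q (scale_family c T t x) = `|c t| * q (T t x).
Proof. by move=> sq; rewrite /scale_family seminormZ// absR_of_real. Qed.

Lemma uniformly_exponentially_stable_pseudo :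
  uniformly_exponentially_stable X T -> pseudo_uniformly_exponentially_stable X T.
Proof. by move=> [w w0 Tw] q Gq; exists w => // B Bb; exact: Tw. Qed.

Lemma uniformly_exponentially_stable_strong :
  uniformly_exponentially_stable X T -> strongly_exponentially_stable X T.
Proof.
move=> [w w0 Tw] x; exists w => //; apply: cvg0_Gamma => q Gq.
by under eq_cvg do rewrite -op_seminorm1; apply: Tw => //; exact: tvs_bounded1.
Qed.

Lemma pseudo_uniformly_exponentially_stable_strong :
  pseudo_uniformly_exponentially_stable X T ->
  pseudo_strongly_exponentially_stable X T.
Proof.
move=> TU q x Gq; have [w w0 Tw] := TU _ Gq; exists w => //.
by under eq_cvg do rewrite -op_seminorm1; apply: Tw; exact: tvs_bounded1.
Qed.

Lemma strongly_exponentially_stable_pseudo :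
  strongly_exponentially_stable X T -> pseudo_strongly_exponentially_stable X T.
Proof.
move=> TS q x Gq; have [w w0 Tw] := TS x; exists w => //.
exact: cvg_Gamma0 Gq Tw.
Qed.

Lemma uniformly_stable_strong : uniformly_stable X T -> strongly_stable X T.
Proof.
move=> TU x; apply: cvg0_Gamma => q Gq.
by under eq_cvg do rewrite -op_seminorm1; apply: TU => //; exact: tvs_bounded1.
Qed.

Hypothesis CT : C0_semigroup T.

Lemma semigroup_seminorm q t : Gamma X q -> 0 <= t ->
  seminorm (q \o T t) /\ continuous (q \o T t).
Proof.
move=> Gq t0; have [/(_ _ t0) Tt _ _ _] := CT.
exact: operator_seminorm Tt (Gamma_seminorm Gq) (Gamma_continuous Gq).
Qed.

Lemma super_polynomially_stable_uniform :
  super_polynomially_stable X T -> uniformly_stable X T.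
Proof.
move=> TS B q Bb Gq; have sq := Gamma_seminorm Gq; have [q0 _ _] := sq.
have Tc := TS _ _ _ (ltr1n R 2) Bb Gq.
apply: (op_seminorm_cvg0 q0 Tc); near=> t => x Bx.
have t1 : 1 <= t by near: t; exact: nbhs_pinfty_ge.
have t0 : 0 <= t by exact: le_trans t1.
have t2 : 1 <= t ^+ 2 by rewrite exprn_ege1.
have [sT cT] := semigroup_seminorm Gq t0.
(* This bound only serves to make the supremum finite; on an unbounded set it would default to 0 and
   dominate nothing. *)
have [C C0 BC] := bounded_seminorm Bb sT cT.
have BC2 y : B y -> q (scale_family (fun s => s `^ 2) T t y) <= t ^+ 2 * C.
  move=> By; rewrite scale_family_seminorm// powR_mulrn// ger0_norm ?exprn_ge0//.
  by rewrite ler_wpM2l ?exprn_ge0//; exact: BC.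
apply: le_trans (op_seminorm_ge BC2 Bx).
rewrite scale_family_seminorm// powR_mulrn// ger0_norm ?exprn_ge0//.
by rewrite ler_peMl.
Unshelve. all: by end_near. Qed.

Lemma pseudo_strongly_exponentially_stable_super_polynomial :
  barrelled X -> exponentially_bounded T ->
  pseudo_strongly_exponentially_stable X T -> super_polynomially_stable X T.
Proof.
move=> barX expT TS alpha B q alpha1 Bb Gq.
have sq := Gamma_seminorm Gq; have [q0 qD _] := sq.
have [n alphan] : exists n, alpha + 1 <= n%:R.
  by exists (Num.bound (alpha + 1)); rewrite ltW// archi_boundP// addr_ge0// ltW// (lt_trans ltr01).
pose A := [set x | forall t, 1 <= t -> t ^+ n * q (T t x) <= 1].
have Tp (t : R) : 1 <= t -> 0 <= t by exact: le_trans.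
have A0 : nbhs 0 A.
  apply: barX.
  (* Absolute convexity: each condition defining [A] bounds a seminorm by 1. *)
  - move=> x y a b Ax Ay; rewrite -!absRE -of_realD -of_real1 ler_of_real => ab t t1.
    have [sT _] := semigroup_seminorm Gq (Tp _ t1); have [_ TD _] := sT.
    apply: le_trans ab; apply: (@le_trans _ _ (t ^+ n * (absR a * q (T t x) + absR b * q (T t y)))).
      rewrite ler_wpM2l ?exprn_ge0 ?Tp// -!(seminormZ _ _ sT).
      exact: TD.
    rewrite mulrDr lerD// mulrCA ler_piMr ?absR_ge0//; [exact: Ax|exact: Ay].
  - move=> x; have [C C0 xC] : exists2 C : R, 0 < C & forall t, 1 <= t -> t ^+ n * q (T t x) <= C.
      have [w w0 /cvgrPdist_le/(_ _ ltr01)[N [_ /= Nw]]] := TS _ x Gq.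
      have [D D0 Dw] := expR_ge_exprn n w0.
      have [p [M [w' [Gp M1 Mp]]]] := expT _ Gq.
      have [p0 _ _] := Gamma_seminorm Gp.
      (* [E] bounds the orbit for t up to N, where exponential boundedness is used; beyond N the
         bound is [D]. The absolute values make the estimate monotone whatever the signs of N and
         w'. *)
      pose E := `|N| ^+ n * (M * expR (`|w'| * `|N|) * p x).
      have E0 : 0 <= E by rewrite !mulr_ge0 ?exprn_ge0 ?expR_ge0// (le_trans ler01).
      exists (D + E) => [|t t1]; first by rewrite ltr_wpDr.
      have t0 := Tp _ t1.
      have [/Nw|tN] := ltP N t.
        rewrite sub0r normrN scale_family_seminorm// (ger0_norm (expR_ge0 _)) => qx.
        apply: (@le_trans _ _ D); last by rewrite lerDl.
        apply: le_trans (ler_wpM2r (q0 _) (Dw _ t0)) _.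
        by rewrite -mulrA ler_piMr ?(ltW D0)// (le_trans (ler_norm _) qx).
      apply: (@le_trans _ _ E); last by rewrite lerDr ltW.
      have tN' : t <= `|N| by exact: le_trans (ler_norm _).
      apply: ler_pM => //; [exact: exprn_ge0|by rewrite lerXn2r ?nnegrE|].
      apply: le_trans (Mp _ _ t0) _; rewrite ler_wpM2r// ler_wpM2l ?(le_trans ler01)//.
      rewrite ler_expR; apply: (@le_trans _ _ (`|w'| * t)).
        by rewrite ler_wpM2r// ler_norm.
      by rewrite ler_wpM2l.
    exists (of_real C); first by rewrite -of_real0 ltr_of_real.
    move=> a; rewrite -absRE ler_of_real => Ca _ ->.
    have a0 : 0 < absR a by exact: lt_le_trans Ca.
    have a1 : a != 0 by apply: contraTneq a0 => ->; rewrite absR0 ltxx.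
    exists (a^-1 *: x); last by rewrite scalerA divff// scale1r.
    move=> t t1; have [sT _] := semigroup_seminorm Gq (Tp _ t1).
    have /= -> := seminormZ a^-1 x sT.
    by rewrite mulrCA absRV ler_pdivrMl// mulr1 (le_trans (xC _ t1)).
  (* Closedness: [A] is an intersection of sublevel sets of continuous functions. *)
  - rewrite (_ : A = \bigcap_(t in [set t | 1 <= t]) [set x | t ^+ n * q (T t x) <= 1]).
      apply: closed_bigI => t t1.
      have [_ cT] := semigroup_seminorm Gq (Tp _ t1).
      apply: (@preimage_closed _ _ (fun x => t ^+ n * q (T t x)) [set y : R | y <= 1]).
        by move=> x _; apply: cvgM; [exact: cvg_cst|exact: cT].
      exact: closed_le.
    by apply/seteqP; split.
have [_ /gt0_of_real[r r0 <-]] := Bb _ A0.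
move=> /(_ (of_real r)); rewrite gtr0_norm -?of_real0 ?ltr_of_real// => /(_ (lexx _)) Br.
(* B lies in r[A], so t^n q(T(t)x) <= r on B, and n >= alpha + 1 leaves the factor 1 / t. *)
apply: (@op_seminorm_cvg0 _ _ _ _ _ _ (fun t => r * t^-1)) => //.
  rewrite -(mulr0 r); apply: cvgM; first exact: cvg_cst.
  by apply/(gtr0_cvgV0 (nbhs_pinfty_gt (num_real 0))); exact: cvg_id.
near=> t => x /Br[u /= Au <-].
have t1 : 1 <= t by near: t; exact: nbhs_pinfty_ge.
have t0 : 0 < t by exact: lt_le_trans t1.
have [sT _] := semigroup_seminorm Gq (Tp _ t1).
rewrite scale_family_seminorm//; have /= -> := seminormZ (of_real r) u sT.
rewrite absR_of_real (gtr0_norm r0) mulrCA ler_wpM2l ?(ltW r0)//.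
rewrite ger0_norm ?powR_ge0// -(ler_pM2l t0) divff ?gt_eqF// mulrA.
by apply: le_trans (Au _ t1); rewrite ler_wpM2r// mulr_powR_le.
Unshelve. all: by end_near. Qed.

End Implications.

(** * Koethe spaces *)

(** A Koethe set of weights, possibly uncountable. Directedness lets balls of a single weight
    generate the topology; positivity of some weight at each index makes the space Hausdorff and
    coordinates continuous. *)
Record weights (R : realType) := Weights {
  weight_set :> (nat -> R) -> Prop ;
  weight_ge0 : forall w, weight_set w -> forall n, 0 <= w n ;
  weight_directed : forall v w, weight_set v -> weight_set w ->
    exists u, [/\ weight_set u, forall n, v n <= u n & forall n, w n <= u n] ;
  weight_gt0 : forall n, exists2 w, weight_set w & 0 < w n
}.

(* One-sided: it is only applied to nonnegative sequences. *)
Definition null_seq (R : realType) (u : nat -> R) :=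
  forall e : R, 0 < e -> exists N, forall n, (N <= n)%N -> u n <= e.

Section Koethe.
Context (R : realType) (k : scalar_kind) (W : weights R).
Local Notation K := (scalar_field R k).

(** Weighted sequences are required to be null rather than bounded, so that c_0 and not l^infinity
    arises from the constant weight; strong stability of a diagonal semigroup with rates tending to
    0 relies on this. *)
Definition koethe_pred : {pred nat -> K^o} := fun x =>
  `[< forall w, W w -> null_seq (fun n => w n * absR (x n)) >].

Fact koethe_submod : submod_closed koethe_pred.
Proof.
split=> [|a x y /asboolP xW /asboolP yW]; apply/asboolP => w Ww e e0.
  by exists 0%N => n _; rewrite absR0 mulr0 ltW.
have d0 : 0 < e / (2 * (absR a + 1)) by rewrite divr_gt0// mulr_gt0// ltr_wpDl ?absR_ge0.
have [M xM] := xW _ Ww _ d0; have [N yN] := yW _ Ww _ (divr_gt0 e0 (@ltr0n R 2)).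
exists (maxn M N) => n; rewrite geq_max => /andP[/xM xn /yN yn].
have w0 := weight_ge0 Ww n.
apply: le_trans (ler_wpM2l w0 (absRD _ _)) _.
rewrite mulrDr (splitr e) lerD// absRM mulrCA.
apply: le_trans (ler_wpM2l (absR_ge0 _) xn) _.
rewrite invfM [e * _]mulrA mulrCA ler_piMr ?divr_ge0 ?(ltW e0)//.
by rewrite ler_pdivrMr ?mul1r ?lerDl// ltr_wpDl ?absR_ge0.
Qed.

HB.instance Definition _ :=
  GRing.isSubmodClosed.Build K (nat -> K^o) koethe_pred koethe_submod.

Record koethe : Type := Koethe {
  koethe_val : nat -> K^o ;
  koethe_valP : koethe_val \in koethe_pred
}.

HB.instance Definition _ := [isSub for koethe_val].
HB.instance Definition _ := [Choice of koethe by <:].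
HB.instance Definition _ := [SubChoice_isSubLmodule of koethe by <:].

Definition coord (x : koethe) (n : nat) : K := koethe_val x n.

Lemma coordD (x y : koethe) n : coord (x + y) n = coord x n + coord y n.
Proof. by []. Qed.

Lemma coordB (x y : koethe) n : coord (x - y) n = coord x n - coord y n.
Proof. by []. Qed.

Lemma coordZ a x n : coord (a *: x) n = a * coord x n.
Proof. by []. Qed.

Lemma coord0 n : coord 0 n = 0.
Proof. by []. Qed.

Lemma coord_inj x y : coord x =1 coord y -> x = y.
Proof. by move=> xy; apply: val_inj; apply/funext. Qed.

Lemma coord_null x w : W w -> null_seq (fun n => w n * absR (coord x n)).
Proof. by have /asboolP := koethe_valP x; apply. Qed.

(* Sealed because unification diverges when it unfolds the supremum. *)
Fact koethe_norm_key : unit. Proof. by []. Qed.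
Definition koethe_norm : (nat -> R) -> koethe -> R :=
  locked_with koethe_norm_key (fun w x => sup (range (fun n => w n * absR (coord x n)))).

Lemma koethe_norm_le w x c : (forall n, w n * absR (coord x n) <= c) -> koethe_norm w x <= c.
Proof.
move=> wc; rewrite [koethe_norm]unlock; apply: ge_sup.
  by exists (w 0%N * absR (coord x 0%N)), 0%N.
by move=> _ [n _ <-].
Qed.

Lemma koethe_norm_ge w x n : W w -> w n * absR (coord x n) <= koethe_norm w x.
Proof.
move=> Ww; rewrite [koethe_norm]unlock; apply: ub_le_sup; last by exists n.
have [N xN] := coord_null x Ww ltr01.
(* The tail is at most 1 and each earlier term is at most the sum of all of them. *)
exists (1 + \sum_(i < N) w i * absR (coord x i)) => _ [m _ <-].
have p0 i : 0 <= w i * absR (coord x i) by rewrite mulr_ge0 ?absR_ge0//; exact: (weight_ge0 Ww).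
have [mN|Nm] := ltnP m N.
  by rewrite (bigD1 (Ordinal mN))//= addrCA lerDl; apply: addr_ge0 => //; apply: sumr_ge0.
by apply: le_trans (xN _ Nm) _; rewrite lerDl sumr_ge0.
Qed.

Lemma koethe_norm_ge0 w x : W w -> 0 <= koethe_norm w x.
Proof.
move=> Ww; apply: le_trans (koethe_norm_ge x 0 Ww).
by rewrite mulr_ge0 ?absR_ge0//; exact: (weight_ge0 Ww).
Qed.

Lemma koethe_normD w (x y : koethe) : W w ->
  koethe_norm w (x + y) <= koethe_norm w x + koethe_norm w y.
Proof.
move=> Ww; apply: koethe_norm_le => n.
have := ler_wpM2l (weight_ge0 Ww n) (absRD (coord x n) (coord y n)).
by move/le_trans; apply; rewrite mulrDr lerD//; exact: koethe_norm_ge.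
Qed.

Lemma koethe_normZ_le w a x : W w -> koethe_norm w (a *: x) <= absR a * koethe_norm w x.
Proof.
move=> Ww; apply: koethe_norm_le => n; rewrite coordZ absRM mulrCA.
by rewrite ler_wpM2l ?absR_ge0//; exact: koethe_norm_ge.
Qed.

Lemma koethe_normZ w a x : W w -> koethe_norm w (a *: x) = absR a * koethe_norm w x.
Proof.
move=> Ww; apply/eqP; rewrite eq_le koethe_normZ_le//=.
have [->|a0] := eqVneq a 0; first by rewrite absR0 mul0r koethe_norm_ge0.
have a1 : 0 < absR a by rewrite absR_gt0.
rewrite mulrC -ler_pdivlMr// mulrC -absRV -{1}(scalerK a0 x).
exact: koethe_normZ_le.
Qed.

Lemma koethe_normB w (x y : koethe) : W w -> koethe_norm w (x - y) = koethe_norm w (y - x).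
Proof. by move=> Ww; rewrite -opprB -scaleN1r koethe_normZ// absRN absR1 mul1r. Qed.

Lemma koethe_norm_triangle w (x y z : koethe) : W w ->
  koethe_norm w (x - z) <= koethe_norm w (x - y) + koethe_norm w (y - z).
Proof. by move=> Ww; rewrite -(subrKA y x (- z)); exact: koethe_normD. Qed.

Lemma koethe_norm0 w : W w -> koethe_norm w 0 = 0.
Proof. by move=> Ww; rewrite -(scale0r 0) koethe_normZ// absR0 mul0r. Qed.

Lemma koethe_norm_mono v w x : W v -> W w -> (forall n, v n <= w n) ->
  koethe_norm v x <= koethe_norm w x.
Proof.
move=> Wv Ww vw; apply: koethe_norm_le => n.
by apply: le_trans (koethe_norm_ge x n Ww); rewrite ler_wpM2r ?absR_ge0.
Qed.

Definition koethe_entourage : set_system (koethe * koethe) := fun A =>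
  exists (w : nat -> R) (e : R), [/\ W w, 0 < e &
    forall x y : koethe, koethe_norm w (x - y) < e -> A (x, y)].

Fact koethe_entourage_filter : Filter koethe_entourage.
Proof.
split=> [|A B [v [d [Wv d0 vA]]] [w [e [Ww e0 wB]]]|A B AB [w [e [Ww e0 wA]]]].
- by have [w Ww _] := weight_gt0 W 0; exists w, 1; split.
- have [u [Wu vu wu]] := weight_directed Wv Ww.
  exists u, (Num.min d e); split; rewrite ?lt_min ?d0// => x y.
  rewrite lt_min => /andP[xd xe]; split.
    by apply: vA; apply: le_lt_trans xd; exact: koethe_norm_mono.
  by apply: wB; apply: le_lt_trans xe; exact: koethe_norm_mono.
- by exists w, e; split => // x y /wA /AB.
Qed.

Fact koethe_entourage_diagonal A : koethe_entourage A -> diagonal `<=` A.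
Proof.
move=> [w [e [Ww e0 wA]]] [x y] /diagonalP/= <-.
by apply: wA; rewrite subrr koethe_norm0.
Qed.

Fact koethe_entourage_inv A : koethe_entourage A -> koethe_entourage A^-1%relation.
Proof.
move=> [w [e [Ww e0 wA]]]; exists w, e; split => // x y xy.
by apply: wA; rewrite koethe_normB.
Qed.

Fact koethe_entourage_split A : koethe_entourage A ->
  exists2 B, koethe_entourage B & (B \; B)%relation `<=` A.
Proof.
move=> [w [e [Ww e0 wA]]].
exists [set xy : koethe * koethe | koethe_norm w (xy.1 - xy.2) < e / 2].
  by exists w, (e / 2); split; rewrite ?divr_gt0.
move=> [x z] /= [y /= xy yz]; apply: wA.
apply: le_lt_trans (koethe_norm_triangle x y z Ww) _.
by rewrite (splitr e) ltrD.
Qed.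

HB.instance Definition _ := isUniform.Build koethe koethe_entourage_filter
  koethe_entourage_diagonal koethe_entourage_inv koethe_entourage_split.

Lemma nbhs_koethe (x : koethe) (U : set koethe) : nbhs x U <->
  exists (w : nat -> R) (e : R), [/\ W w, 0 < e &
    forall y : koethe, koethe_norm w (x - y) < e -> U y].
Proof.
split=> [|[w [e [Ww e0 wU]]]].
  move=> [A [w [e [Ww e0 wA]]] AU]; exists w, e; split => // y xy.
  by apply: AU; rewrite /xsection/= inE; exact: wA.
exists [set xy : koethe * koethe | koethe_norm w (xy.1 - xy.2) < e].
  by exists w, e; split => // u v uv.
by move=> y; rewrite /xsection/= inE; exact: wU.
Qed.

Fact koethe_add_continuous : continuous (fun x : koethe * koethe => x.1 + x.2).
Proof.
move=> [x y] U /nbhs_koethe[w [e [Ww e0 wU]]] /=.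
have e2 : 0 < e / 2 by rewrite divr_gt0.
exists ([set z : koethe | koethe_norm w (x - z) < e / 2],
  [set z : koethe | koethe_norm w (y - z) < e / 2]).
  by split; apply/nbhs_koethe; exists w, (e / 2).
move=> [u v] [/= xu yv]; apply: wU => /=; rewrite opprD addrACA.
by apply: le_lt_trans (koethe_normD _ _ Ww) _; rewrite (splitr e) ltrD.
Qed.

Fact koethe_scale_continuous : continuous (fun z : K^o * koethe => z.1 *: z.2).
Proof.
move=> [a x] U /nbhs_koethe[w [e [Ww e0 wU]]] /=.
have x0 := koethe_norm_ge0 x Ww.
(* Chosen so that d < 1, hence d(|x| + |a| + d) < e, where |x| is the norm of x for w. *)
pose d := e / (koethe_norm w x + absR a + e + 1).
have s0 : 0 < koethe_norm w x + absR a + e + 1 by rewrite ltr_wpDl// !addr_ge0 ?absR_ge0// ltW.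
have d0 : 0 < d by rewrite divr_gt0.
have de : d * (koethe_norm w x + absR a + e + 1) = e by rewrite divfK// gt_eqF.
have d1 : d < 1 by rewrite ltr_pdivrMr// mul1r -addrA ltr_wpDl ?addr_ge0 ?absR_ge0// ltrDl.
exists ([set b | absR (a - b) < d], [set z : koethe | koethe_norm w (x - z) < d]).
  by split; [apply/nbhs_absR; exists d|apply/nbhs_koethe; exists w, d].
move=> [b y] [/= ab xy]; apply: wU => /=.
(* This splitting involves only a and x besides the small differences a - b and x - y. *)
rewrite (_ : a *: x - b *: y = (a - b) *: x + (a *: (x - y) - (a - b) *: (x - y))); last first.
  by rewrite -scalerBl opprB addrCA subrr addr0 scalerBl scalerBr addrA subrK.
apply: le_lt_trans (koethe_normD _ _ Ww) _.
apply: (@le_lt_trans _ _ (d * koethe_norm w x + (absR a * d + d * d))).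
  rewrite koethe_normZ// lerD// ?ler_wpM2r// ?(ltW ab)//.
  apply: le_trans (koethe_normD _ _ Ww) _; rewrite -scaleNr !koethe_normZ// lerD//.
    by rewrite ler_wpM2l ?absR_ge0// ltW.
  by rewrite absRN ler_pM ?absR_ge0 ?koethe_norm_ge0// ltW.
rewrite -[ltRHS]de [_ * d]mulrC -!mulrDr ltr_pM2l//; lra.
Qed.

Lemma open_koethe_ball w (x : koethe) (e : R) : W w ->
  open [set y : koethe | koethe_norm w (x - y) < e].
Proof.
move=> Ww; rewrite openE => y /= xy; apply/nbhs_koethe.
exists w, (e - koethe_norm w (x - y)); split; rewrite ?subr_gt0// => z yz /=.
apply: le_lt_trans (koethe_norm_triangle x y z Ww) _.
by rewrite -ltrBrDl.
Qed.

Fact koethe_locally_convex : exists2 B : set_system koethe,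
  (forall b, b \in B -> convex_set b) & basis B.
Proof.
exists [set B | exists (w : nat -> R) (x : koethe) (e : R),
  W w /\ B = [set y : koethe | koethe_norm w (x - y) < e]].
  move=> _ /[!inE] -[w [x [e [Ww ->]]]].
  apply/convex_setW => y z; rewrite !inE/= => xy xz l l0 l1.
  rewrite inE/=.
  have [s s0 sl] := gt0_of_real l0.
  have s1 : s < 1 by rewrite -(ltr_of_real k) sl of_real1.
  rewrite (_ : x - _ = of_real s *: (x - y) + of_real (1 - s) *: (x - z)); last first.
    have -> : conv l y z = of_real s *: y + (1 - of_real s) *: z :> koethe by rewrite sl.
    rewrite of_realD of_real1 of_realN !scalerBr addrACA -scalerDl subrKC scale1r.
    by rewrite opprD.
  apply: le_lt_trans (koethe_normD _ _ Ww) _; rewrite !koethe_normZ// !absR_of_real.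
  rewrite (gtr0_norm s0) gtr0_norm ?subr_gt0//.
  nra.
split; first by move=> B [w [x [e [Ww ->]]]]; exact: open_koethe_ball.
move=> x U /nbhs_koethe[w [e [Ww e0 wU]]].
exists [set y : koethe | koethe_norm w (x - y) < e]; last exact: wU.
by split; [exists w, x, e|rewrite /= subrr koethe_norm0].
Qed.

HB.instance Definition _ :=
  PreTopologicalNmodule_isTopologicalNmodule.Build koethe koethe_add_continuous.
HB.instance Definition _ :=
  TopologicalNmodule_isTopologicalLmodule.Build K koethe koethe_scale_continuous.
HB.instance Definition _ :=
  Uniform_isTvs.Build K koethe koethe_locally_convex.

End Koethe.

(** * Koethe spaces as Hausdorff, Mackey complete locally convex spaces *)

Section KoetheLcs.
Context (R : realType) (k : scalar_kind) (W : weights R).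
Local Notation K := (scalar_field R k).
Local Notation X := (koethe k W).

Lemma koethe_norm_seminorm w : W w -> seminorm (koethe_norm w : X -> R).
Proof.
move=> Ww; apply: seminormP => [x|x y|a x].
- exact: koethe_norm_ge0.
- exact: koethe_normD.
- exact: koethe_normZ.
Qed.

Lemma koethe_norm_continuous w : W w -> continuous (koethe_norm w : X -> R).
Proof.
move=> Ww; apply: continuous_seminorm; first exact: koethe_norm_seminorm.
apply/nbhs_koethe; exists w, 1; split => // y.
by rewrite sub0r -scaleN1r koethe_normZ// absRN absR1 mul1r.
Qed.

Definition koethe_Gamma : set (X -> R) := [set q | exists2 w, W w & q = koethe_norm w].

Lemma koethe_fundamental : fundamental_system koethe_Gamma.
Proof.
split=> [_ [w Ww ->]|p sp cp].
  by split; [exact: koethe_norm_seminorm|exact: koethe_norm_continuous].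
have /nbhs_koethe[w [e [Ww e0 we]]] := nbhs_seminorm cp sp ltr01.
exists (koethe_norm w), e^-1; split; [by exists w|by rewrite invr_ge0 ltW|move=> x].
(* The term de keeps c positive when the norm of x vanishes. Scaling x by e / c brings it into the
   ball of radius e, so p x < c / e, which is the norm of x over e plus d. *)
apply/ler_addgt0Pr => d d0; pose c := koethe_norm w x + d * e.
have c0 : 0 < c by rewrite ltr_wpDl ?koethe_norm_ge0// mulr_gt0.
have ec0 : 0 < e / c by rewrite divr_gt0.
have : p (of_real (- (e / c)) *: x) < 1.
  apply: we; rewrite sub0r -scaleNr -of_realN opprK koethe_normZ// absR_of_real gtr0_norm//.
  by rewrite mulrAC ltr_pdivrMr// ltr_pM2l// ltrDl mulr_gt0.
rewrite seminormZ// absR_of_real normrN gtr0_norm// -ltr_pdivlMl// mulr1 invf_div => /ltW.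
move=> /le_trans; apply.
by rewrite /c mulrDl mulfK ?gt_eqF// mulrC.
Qed.

Lemma koethe_hausdorff : hausdorff_space X.
Proof.
move=> x y xy; apply: coord_inj => n; have [w Ww wn] := weight_gt0 W n.
apply/eqP; rewrite -subr_eq0; apply/eqP/absR0_eq0/eqP.
suff : w n * absR (coord (x - y) n) == 0 by rewrite mulf_eq0 gt_eqF.
rewrite eq_le.
have w0 := weight_ge0 Ww n; rewrite (mulr_ge0 w0 (absR_ge0 _)) andbT.
apply/ler_addgt0Pr => e e0; rewrite add0r; have e2 : 0 < e / 2 by rewrite divr_gt0.
have nb u : nbhs u [set z : X | koethe_norm w (u - z) < e / 2].
  by apply/nbhs_koethe; exists w, (e / 2).
have [z [/= xz yz]] := xy _ _ (nb x) (nb y).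
apply: le_trans (koethe_norm_ge (x - y) n Ww) _.
apply: le_trans (koethe_norm_triangle x z y Ww) _.
by rewrite (koethe_normB z y Ww) (splitr e) lerD// ltW.
Qed.

Definition koethe_lcs : lcs R k := Lcs koethe_hausdorff koethe_fundamental.

Lemma koethe_norm_Gamma w : W w -> Gamma koethe_lcs (koethe_norm w).
Proof. by move=> Ww; exists w. Qed.

Definition koethe_of (x : nat -> K) : X := insubd 0 (x : nat -> K^o).

Lemma koethe_ofE (x : nat -> K) :
  (forall w, W w -> null_seq (fun n => w n * absR (x n))) -> coord (koethe_of x) = x.
Proof.
move=> xW; rewrite /coord /koethe_of.
have xP : (x : nat -> K^o) \in koethe_pred W by apply/asboolP.
by have := insubdK (0 : X) xP.
Qed.

(** Limits exist coordinatewise because every index carries a positive weight. The Cauchy estimate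
    passes to the limit uniformly in the index, and a uniform limit of null sequences is null. *)
Lemma koethe_complete (x : nat -> X) :
  (forall w (e : R), W w -> 0 < e -> exists N, forall m n, (N <= m)%N -> (N <= n)%N ->
     koethe_norm w (x m - x n) <= e) ->
  exists l : X, forall w (e : R), W w -> 0 < e -> exists N, forall n, (N <= n)%N ->
     koethe_norm w (x n - l) <= e.
Proof.
move=> xC.
have /choice[l xl] : forall i, exists l : K, forall e : R, 0 < e -> exists N, forall n,
    (N <= n)%N -> absR (coord (x n) i - l) <= e.
  move=> i; apply: absR_complete => e e0; have [w Ww wi] := weight_gt0 W i.
  have [N xN] := xC w (w i * e) Ww (mulr_gt0 wi e0).
  exists N => m n Nm Nn; rewrite -(ler_pM2l wi) -coordB.
  exact: le_trans (koethe_norm_ge _ _ Ww) (xN _ _ Nm Nn).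
have xlw w (e : R) : W w -> 0 < e -> exists N, forall n, (N <= n)%N -> forall i,
    w i * absR (coord (x n) i - l i) <= e.
  move=> Ww e0; have [N xN] := xC _ _ Ww e0; exists N => n Nn i.
  have w0 := weight_ge0 Ww i.
  apply/ler_addgt0Pr => d d0; have w1 : 0 < w i + 1 by rewrite ltr_wpDl.
  (* The intermediate index m may depend on i; it disappears from the final bound. Division by w i +
     1 allows w i = 0. *)
  have [M xM] := xl i _ (divr_gt0 d0 w1); pose m := maxn M N.
  rewrite -(subrKA (coord (x m) i)).
  apply: le_trans (ler_wpM2l w0 (absRD _ _)) _; rewrite mulrDr lerD//.
    rewrite -coordB; apply: le_trans (koethe_norm_ge _ _ Ww) _.
    by apply: xN => //; exact: leq_maxr.
  apply: le_trans (ler_wpM2l w0 (xM m (leq_maxl _ _))) _.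
  by rewrite mulrCA ler_piMr ?(ltW d0)// ler_pdivrMr// mul1r lerDl.
have lW w : W w -> null_seq (fun n => w n * absR (l n)).
  move=> Ww e e0; have e2 : 0 < e / 2 by rewrite divr_gt0.
  have [N /(_ _ (leqnn N)) xN] := xlw _ _ Ww e2.
  have [M xM] := coord_null (x N) Ww e2; exists M => i Mi.
  rewrite -[l i]subr0 -(subrKA (coord (x N) i)) subr0.
  apply: le_trans (ler_wpM2l (weight_ge0 Ww i) (absRD _ _)) _.
  by rewrite mulrDr (splitr e) lerD ?xM// absR_dist.
exists (koethe_of l) => w e Ww e0; have [N xN] := xlw _ _ Ww e0; exists N => n Nn.
by apply: koethe_norm_le => i; rewrite coordB koethe_ofE//; exact: xN.
Qed.

Lemma koethe_mackey_complete : mackey_complete koethe_lcs.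
Proof.
move=> x [B [b [Bb b0 xB]]].
have [|l xl] := koethe_complete (x := x).
  move=> w e Ww e0.
  (* On B the norm is at most C, so coefficients below e / (C + 1) give differences of norm at most
     e. *)
  have [C C0 BC] := bounded_seminorm Bb (koethe_norm_seminorm Ww) (koethe_norm_continuous Ww).
  have C1 : 0 < C + 1 by rewrite ltr_wpDl.
  have /b0 [[P Q] /= [[M _ PM] [N _ QN]] PQ] : nbhs (0 : K) [set a | absR a < e / (C + 1)].
    apply/nbhs_absR; exists (e / (C + 1)); rewrite ?divr_gt0// => a.
    by rewrite sub0r absRN.
  exists (maxn M N) => m n; rewrite !geq_max => /andP[Mm Nm] /andP[Mn Nn].
  have [u Bu <-] := xB m n.
  have /= bmn := PQ (m, n) (conj (PM _ Mm) (QN _ Nn)).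
  rewrite koethe_normZ//.
  apply: (@le_trans _ _ (e / (C + 1) * C)).
    by rewrite ler_pM ?absR_ge0 ?koethe_norm_ge0// ?(ltW bmn)// BC.
  by rewrite mulrAC ler_pdivrMr// ler_pM2l// lerDl.
exists l => U /nbhs_koethe[w [e [Ww e0 wU]]].
have e2 : 0 < e / 2 by rewrite divr_gt0.
have [N xN] := xl _ _ Ww e2; exists N => // n /= Nn; apply: wU.
rewrite koethe_normB//; apply: le_lt_trans (xN _ Nn) _.
by rewrite ltr_pdivrMr// ltr_pMr// ltr1n.
Qed.

End KoetheLcs.

(** * Diagonal semigroups *)

(** For u <= v the difference is exp(-u)(1 - exp(-(v - u))), where the first factor is at most 1 and
    the second at most v - u. *)
Lemma expRN_dist (R : realType) (a b : R) : 0 <= a -> 0 <= b ->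
  `|expR (- a) - expR (- b)| <= `|a - b|.
Proof.
have le (u v : R) : 0 <= u -> u <= v -> `|expR (- u) - expR (- v)| <= `|u - v|.
  move=> u0 uv; rewrite distrC (distrC u) ler0_norm ?subr_le0 ?ler_expR ?lerN2//.
  rewrite opprB ger0_norm ?subr_ge0// (_ : - v = - u - (v - u)); last by ring.
  rewrite expRD -{1}[expR (- u)]mulr1 -mulrBr.
  apply: (@le_trans _ _ (1 - expR (- (v - u)))).
    rewrite ler_piMl ?subr_ge0//; last by rewrite -expR0 ler_expR oppr_le0.
    by rewrite -expR0 ler_expR oppr_le0 subr_ge0.
  by rewrite lerBlDr addrC -lerBlDr (le_trans _ (expR_ge1Dx _)).
move=> a0 b0; have [ab|/ltW ba] := leP a b; first exact: le.
by rewrite distrC (distrC a); exact: le.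
Qed.

Section DiagonalSemigroup.
Context (R : realType) (k : scalar_kind) (W : weights R).
Local Notation X := (koethe_lcs k W).
Variable l : nat -> R.

(* The absolute value only makes the operators bounded for negative times. *)
Definition diag (t : R) (x : X) : X :=
  koethe_of W (fun n => of_real (expR (- (l n * `|t|))) * coord x n).

Hypothesis l01 : forall n, 0 <= l n <= 1.

Lemma diag_coord t x n : 0 <= t ->
  coord (diag t x) n = of_real (expR (- (l n * t))) * coord x n.
Proof.
move=> t0; rewrite koethe_ofE ?ger0_norm// => w Ww e e0.
have [N xN] := coord_null x Ww e0; exists N => m /xN; apply: le_trans.
rewrite absRM absR_of_real ger0_norm ?expR_ge0// mulrCA.
rewrite ler_piMl ?mulr_ge0 ?absR_ge0 ?(weight_ge0 Ww)//.
by rewrite -expR0 ler_expR oppr_le0 mulr_ge0//; case/andP: (l01 m).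
Qed.

Lemma diag_linear t : 0 <= t -> linear (diag t).
Proof.
move=> t0 a x y; apply: coord_inj => n.
by rewrite coordD coordZ !diag_coord// coordD coordZ mulrDr mulrCA.
Qed.

Lemma diag_norm_le w t x : W w -> 0 <= t -> koethe_norm w (diag t x) <= koethe_norm w x.
Proof.
move=> Ww t0; apply: koethe_norm_le => n; apply: le_trans (koethe_norm_ge x n Ww).
rewrite diag_coord// absRM absR_of_real ger0_norm ?expR_ge0// mulrCA.
rewrite ler_piMl ?mulr_ge0 ?absR_ge0 ?(weight_ge0 Ww)//.
by rewrite -expR0 ler_expR oppr_le0 mulr_ge0//; case/andP: (l01 n).
Qed.

(** Rates at most 1 make the Lipschitz estimate in time uniform over the coordinates; strong
    continuity follows at once. *)
Lemma diag_norm_dist w s t x : W w -> 0 <= s -> 0 <= t ->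
  koethe_norm w (diag s x - diag t x) <= `|s - t| * koethe_norm w x.
Proof.
move=> Ww s0 t0; apply: koethe_norm_le => n; have /andP[l0 l1] := l01 n.
rewrite coordB !diag_coord// -mulrBl -of_realN -of_realD absRM absR_of_real mulrCA.
rewrite ler_pM ?mulr_ge0 ?absR_ge0 ?(weight_ge0 Ww)//; last exact: koethe_norm_ge.
apply: le_trans (expRN_dist _ _) _; rewrite ?mulr_ge0//.
by rewrite -mulrBr normrM ger0_norm// ler_piMl.
Qed.

Lemma diag_C0_semigroup : C0_semigroup (X := X) diag.
Proof.
split.
- move=> t t0; split; first exact: diag_linear.
  move=> x U /nbhs_koethe[w [e [Ww e0 wU]]]; apply/nbhs_koethe.
  exists w, e; split => // y xy; apply: wU.
  have -> : diag t x - diag t y = diag t (x - y).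
    by rewrite -scaleN1r addrC -diag_linear// scaleN1r addrC.
  by apply: le_lt_trans xy; exact: diag_norm_le.
- move=> x; apply: coord_inj => n.
  by rewrite diag_coord// mulr0 oppr0 expR0 of_real1 mul1r.
- move=> s t s0 t0 x; apply: coord_inj => n.
  by rewrite !diag_coord ?addr_ge0// mulrDr opprD expRD of_realM mulrA.
- move=> t0 x t00 U /nbhs_koethe[w [e [Ww e0 wU]]].
  have x1 : 0 < koethe_norm w x + 1 by rewrite ltr_wpDl ?koethe_norm_ge0.
  exists (e / (koethe_norm w x + 1)) => /=; first by rewrite divr_gt0.
  move=> t /= tt0 t0'; apply: wU.
  apply: le_lt_trans (diag_norm_dist _ Ww t00 t0') _.
  apply: (@le_lt_trans _ _ (`|t0 - t| * (koethe_norm w x + 1))).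
    by rewrite ler_wpM2l// lerDl.
  by rewrite -ltr_pdivlMr.
Qed.

Lemma diag_exponentially_bounded : exponentially_bounded (X := X) diag.
Proof.
move=> _ [w Ww ->]; exists (koethe_norm w), 1, 0; split => //; first by exists w.
by move=> t x t0; rewrite mul0r expR0 !mul1r diag_norm_le.
Qed.

Lemma diag_admissible : barrelled X -> admissible (X := X) diag.
Proof.
move=> bX; split => //; first exact: koethe_mackey_complete.
- exact: diag_C0_semigroup.
- exact: diag_exponentially_bounded.
Qed.

End DiagonalSemigroup.

(** * Barrelledness *)

Section KoetheBarrelled.
Context (R : realType) (k : scalar_kind) (W : weights R).
Local Notation K := (scalar_field R k).
Local Notation X := (koethe_lcs k W).

Lemma koethe_absorbing (A : set X) (x : X) : absorbing A ->
  exists2 r : R, 0 < r & forall a : K, r <= absR a -> A (a^-1 *: x).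
Proof.
move=> /(_ x)[_ /gt0_of_real[r r0 <-] rA]; exists r => // a ra.
have a0 : a != 0 by apply: contraTneq ra => ->; rewrite absR0 -ltNge.
have [|u Au <-] := rA a _ x erefl; first by rewrite -absRE ler_of_real.
by rewrite scalerA mulVf// scale1r.
Qed.

(* Baire's argument: a sequence of shrinking balls such that the n-th one misses (n+1)A. *)
Lemma koethe_barrelled_seq (v : nat -> nat -> R) :
  (forall j, W (v j)) -> (forall i j n, (i <= j)%N -> v i n <= v j n) ->
  (forall w, W w -> exists j, forall n, w n <= v j n) -> barrelled X.
Proof.
move=> Wv vmono vcof A Aconv Aabs Acl; apply: contrapT => A0.
pose nm j (x : X) := koethe_norm (v j) x.
pose S m (x : X) := A (of_real m.+1%:R^-1 *: x).
have nmono i j x : (i <= j)%N -> nm i x <= nm j x.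
  by move=> ij; apply: koethe_norm_mono => // n; exact: vmono.
have wnm w : W w -> exists j, forall x : X, koethe_norm w x <= nm j x.
  move=> Ww; have [j wj] := vcof _ Ww; exists j => x; exact: koethe_norm_mono.
(* [S m] is (m + 1)A. If it contained a ball about x, then half the difference of x + (m + 1)z and x
   - (m + 1)z, divided by m + 1, would put every small z into A. *)
have esc m j x (e : R) : 0 < e -> exists y, nm j (x - y) < e /\ ~ S m y.
  move=> e0; apply: contrapT => H; apply: A0; apply/nbhs_koethe.
  have HS y : nm j (x - y) < e -> S m y.
    by move=> xy; apply: contrapT => nS; apply: H; exists y.
  have m0 : 0 < m.+1%:R :> R by rewrite ltr0n.
  exists (v j), (e / m.+1%:R); split; [exact: Wv|exact: divr_gt0|move=> z].
  rewrite koethe_normB// subr0 ltr_pdivlMr// => ze.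
  pose M : K := of_real m.+1%:R.
  have Mz : nm j (M *: z) < e.
    by rewrite /nm koethe_normZ// absR_of_real gtr0_norm// mulrC.
  have S1 : S m (x + M *: z).
    apply: HS; rewrite opprD addNKr -scaleN1r /nm koethe_normZ// absRN absR1 mul1r.
    exact: Mz.
  have S2 : S m (x - M *: z) by apply: HS; rewrite opprB subrKC.
  have := Aconv _ _ (of_real 2^-1) (of_real (- 2^-1)) S1 S2.
  rewrite -!absRE !absR_of_real normrN -of_realD -of_real1 ler_of_real ger0_norm//.
  have -> : 2^-1 + 2^-1 = 1 :> R by field.
  move=> /(_ (lexx _)); rewrite of_realN scaleNr -!scalerBr opprB addrC addrA subrK.
  have -> : M *: z + M *: z = of_real (m.+1%:R * 2) *: z.
    by rewrite -scalerDl -of_realD mulrDr mulr1.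
  rewrite !scalerA -!of_realM (_ : _ * _ = 1) ?of_real1 ?scale1r//.
  by field; rewrite gt_eqF.
have Sclosed m y : ~ S m y -> exists j (e : R), 0 < e /\
    forall z, nm j (y - z) <= e -> ~ S m z.
  move=> nS; have : nbhs (of_real m.+1%:R^-1 *: y) (~` A).
    by apply: open_nbhs_nbhs; split => //; exact: closed_openC.
  move=> /nbhs_koethe[w [d [Ww d0 wd]]]; have [j wj] := wnm _ Ww.
  exists j, (d / 2); split; first by rewrite divr_gt0.
  move=> z yz; apply: wd; rewrite -scalerBr koethe_normZ// absR_of_real gtr0_norm ?invr_gt0//.
  apply: (@le_lt_trans _ _ (nm j (y - z))).
    by rewrite mulrC ler_pdivrMr// (le_trans (wj _))// ler_peMr ?koethe_norm_ge0// ler1n.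
  by apply: le_lt_trans yz _; rewrite ltr_pdivrMr// ltr_pMr// ltr1n.
(* A state holds a centre, the index of a norm and a radius. In a step the radius at least halves,
   the index grows, the centre moves by at most half the old radius, and the new closed ball misses
   (m + 1)A. *)
pose rel m (s s' : X * (nat * R)) :=
  [/\ 0 < s'.2.2, s'.2.2 <= s.2.2 / 2, s'.2.2 <= m.+1%:R^-1, (s.2.1 < s'.2.1)%N &
   nm s.2.1 (s.1 - s'.1) <= s.2.2 / 2 /\ forall z, nm s'.2.1 (s'.1 - z) <= s'.2.2 -> ~ S m z].
have /choice[f fP] : forall p : nat * (X * (nat * R)),
    exists s', 0 < p.2.2.2 -> rel p.1 p.2 s'.
  (* A state with nonpositive radius is returned unchanged, which makes the successor function
     total. *)
  move=> [m [x [j e]]] /=; have [e0|] := boolP (0 < e); last by exists (x, (j, e)).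
  have e2 : 0 < e / 2 by rewrite divr_gt0.
  have [y [xy /Sclosed[i [d [d0 yd]]]]] := esc m j x _ e2.
  exists (y, (maxn i j.+1, Num.min d (Num.min (e / 2) m.+1%:R^-1))) => _; split => /=.
  - by rewrite !lt_min d0 e2 invr_gt0 ltr0n.
  - by rewrite !ge_min lexx !orbT.
  - by rewrite !ge_min lexx !orbT.
  - exact: leq_maxr.
  - split; first exact: ltW.
    move=> z; rewrite le_min => /andP[yz _]; apply: yd; apply: le_trans yz.
    by apply: nmono; exact: leq_maxl.
pose s n := iteri n (fun i p => f (i, p)) (0 : X, (0%N, 1 : R)).
pose x n := (s n).1; pose j n := (s n).2.1; pose e n := (s n).2.2.
have e0 n : 0 < e n by elim: n => [|n IH]; [exact: ltr01|have [] := fP (n, s n) IH].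
have srel n : rel n (s n) (s n.+1) := fP (n, s n) (e0 n).
have jS n : (j n < j n.+1)%N by have [] := srel n.
have jmono n m : (n <= m)%N -> (j n <= j m)%N.
  exact: (homo_leq (r := leq) leqnn leq_trans (fun i => ltnW (jS i))).
have jge n : (n <= j n)%N by elim: n => // n IH; exact: leq_ltn_trans (jS n).
have eS n : e n.+1 <= n.+1%:R^-1 by have [] := srel n.
(* Telescoping: a step moves by at most e n / 2, which is at most e n - e (n + 1) by halving. *)
have tail n m : nm (j n) (x n - x (n + m)%N) <= e n - e (n + m)%N.
  elim: m => [|m IH]; first by rewrite addn0 !subrr /nm koethe_norm0.
  apply: le_trans (koethe_norm_triangle _ (x (n + m)%N) _ (Wv _)) _.
  have [_ e2 _ _ [x2 _]] := srel (n + m)%N.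
  have := le_trans (nmono _ _ _ (jmono _ _ (leq_addr m n))) x2.
  move: IH e2; rewrite addnS -/(x _) -/(x _) -/(e _) -/(e _) /nm; lra.
have tail_le n m : (n <= m)%N -> nm (j n) (x n - x m) <= e n.
  by move=> /subnKC <-; apply: le_trans (tail _ _) _; rewrite gerBl ltW.
have [|l xl] := koethe_complete (x := x).
  move=> w d Ww d0; have [i wi] := wnm _ Ww.
  have d2 : 0 < d / 2 by rewrite divr_gt0.
  (* From stage N on, the norm index is at least i and the radius at most 1 / N <= d / 2. *)
  pose N := (maxn i (Num.bound (d / 2)^-1)).+1.
  have eN : e N <= d / 2.
    apply: le_trans (eS _) _; rewrite -[leRHS]invrK lef_pV2 ?posrE ?invr_gt0 ?ltr0n//.
    apply: le_trans (ltW (archi_boundP _)) _; first by rewrite invr_ge0 ltW.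
    by rewrite ler_nat leqW// leq_maxr.
  have iN : (i <= j N)%N by apply: leq_trans (jge N); rewrite leqW// leq_maxl.
  exists N => m n Nm Nn; rewrite (splitr d).
  apply: le_trans (koethe_norm_triangle _ (x N) _ Ww) _.
  rewrite (koethe_normB (x m))// lerD// (le_trans (wi _))// (le_trans (nmono _ _ _ iN))//.
    exact: le_trans (tail_le _ _ Nm) eN.
  exact: le_trans (tail_le _ _ Nn) eN.
have xle n : nm (j n) (x n - l) <= e n.
  apply/ler_addgt0Pr => d d0; have [N xN] := xl _ _ (Wv (j n)) d0.
  apply: le_trans (koethe_norm_triangle _ (x (maxn n N)) _ (Wv _)) _.
  by rewrite lerD ?tail_le ?xN ?leq_maxl ?leq_maxr.
(* The limit lies in all the closed balls, hence in no (m + 1)A, whereas it lies in aA for every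
   scalar a of modulus at least r. *)
have [r r0 rA] := koethe_absorbing l Aabs.
have [_ _ _ _ [_ /(_ l)]] := srel (Num.bound r).
apply; first exact: xle.
rewrite /S -[of_real _]invrK; apply: rA.
rewrite absRV absR_of_real gtr0_norm ?invr_gt0 ?ltr0n// invrK.
apply: le_trans (ltW (archi_boundP (ltW r0))) _.
by rewrite ler_nat.
Qed.

End KoetheBarrelled.

(** * Unit vectors and a boundedness criterion *)

Section UnitVectors.
Context (R : realType) (k : scalar_kind) (W : weights R).
Local Notation K := (scalar_field R k).
Local Notation X := (koethe_lcs k W).

Definition unit_vec (i : nat) : X := koethe_of W (fun n => (n == i)%:R : K).

Lemma coord_unit i n : coord (unit_vec i) n = (n == i)%:R.
Proof.
rewrite koethe_ofE// => w Ww e e0; exists i.+1 => m im.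
by rewrite gtn_eqF// absR0 mulr0 ltW.
Qed.

Lemma coord_sum (I : Type) (r : seq I) (F : I -> X) n :
  coord (\sum_(i <- r) F i) n = \sum_(i <- r) coord (F i) n.
Proof.
by elim: r => [|i r IH]; rewrite ?big_nil ?coord0// !big_cons coordD IH.
Qed.

Lemma koethe_bounded (B : set X) :
  (forall w, W w -> exists C : R, forall x, B x -> koethe_norm w x <= C) -> tvs_bounded B.
Proof.
move=> BC U /nbhs_koethe[w [e [Ww e0 wU]]]; have [C xC] := BC _ Ww.
have r0 : 0 < (`|C| + 1) / e by rewrite divr_gt0// ltr_wpDl.
exists (of_real ((`|C| + 1) / e)); first by rewrite -of_real0 ltr_of_real.
move=> a; rewrite -absRE ler_of_real => ra x Bx.
have a0 : 0 < absR a by exact: lt_le_trans ra.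
have a1 : a != 0 by apply: contraTneq a0 => ->; rewrite absR0 ltxx.
exists (a^-1 *: x); last by rewrite scalerA divff// scale1r.
apply: wU; rewrite koethe_normB// subr0 koethe_normZ// absRV ltr_pdivrMl//.
apply: le_lt_trans (xC _ Bx) _; apply: le_lt_trans (ler_norm C) _.
by apply: (@lt_le_trans _ _ (`|C| + 1)); [rewrite ltrDl|rewrite -ler_pdivrMr].
Qed.

End UnitVectors.

(** * The direct sum: finite supports and barrelledness *)

Section AllWeights.
Context (R : realType).

Fact all_weights_directed (v w : nat -> R) : (forall n, 0 <= v n) -> (forall n, 0 <= w n) ->
  exists u : nat -> R, [/\ forall n, 0 <= u n, forall n, v n <= u n & forall n, w n <= u n].
Proof.
move=> v0 w0; exists (fun n => v n + w n); split => n; first exact: addr_ge0.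
- by rewrite lerDl.
- by rewrite lerDr.
Qed.

Fact all_weights_gt0 (n : nat) :
  exists2 w : nat -> R, (forall n, 0 <= w n) & 0 < w n.
Proof. by exists (fun=> 1). Qed.

(* The Koethe space of these weights is the space of finitely supported sequences with its
   finest locally convex topology. *)
Definition all_weights : weights R :=
  @Weights R (fun w => forall n, 0 <= w n) (fun w w0 => w0) all_weights_directed
    all_weights_gt0.

Context (k : scalar_kind).
Local Notation K := (scalar_field R k).
Local Notation X := (koethe_lcs k all_weights).

(** The weight 1 / |x_n|, which is 0 where x_n = 0, gives every nonzero coordinate the weighted size
    1, so nullity leaves finitely many of them. *)
Lemma all_weights_finite (x : X) : exists N, forall n, (N <= n)%N -> coord x n = 0.
Proof.
have w0 : all_weights (fun n => (absR (coord x n))^-1).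
  by move=> n; rewrite invr_ge0 absR_ge0.
have [N xN] := coord_null x w0 (divr_gt0 ltr01 (@ltr0n R 2)).
exists N => n /xN; have [->//|xn0] := eqVneq (coord x n) 0.
have a0 : absR (coord x n) != 0 by rewrite gt_eqF// absR_gt0.
by rewrite mulVf// ler_pdivlMr// mul1r lern1.
Qed.

Lemma all_weights_expansion (x : X) N : (forall n, (N <= n)%N -> coord x n = 0) ->
  x = \sum_(i < N) coord x i *: unit_vec k all_weights i.
Proof.
move=> xN; apply: coord_inj => n; rewrite coord_sum.
under eq_bigr do rewrite coordZ coord_unit.
have [nN|/[dup] Nn /xN ->] := ltnP n N.
  rewrite (bigD1 (Ordinal nN))//= eqxx mulr1 big1 ?addr0// => i ni.
  by rewrite (_ : (n == i) = false) ?mulr0//; apply: contra_neqF ni => /eqP ni; exact: val_inj.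
by rewrite big1// => i _; rewrite gtn_eqF ?mulr0// (leq_trans (ltn_ord i)).
Qed.

Lemma all_weights_barrelled : barrelled X.
Proof.
move=> A Aconv Aabs _; pose u i := unit_vec k all_weights i.
have A0 : A 0.
  have [r r0 rA] := koethe_absorbing 0 Aabs.
  have := rA (of_real r); rewrite absR_of_real gtr0_norm// scaler0; exact.
have /choice[r rP] : forall i, exists r : R, 0 < r /\
    forall a : K, r <= absR a -> A (a^-1 *: u i).
  by move=> i; have [r] := koethe_absorbing (u i) Aabs; exists r.
(* Combinations with coefficients 1/2, 1/4, ... stay in A: half of the first vector plus half of a
   shorter combination of the same form. *)
have geomA N (y : nat -> X) : (forall i, A (y i)) ->
    A (\sum_(i < N) of_real (2^-1 ^+ i.+1) *: y i).
  elim: N y => [|N IH] y Ay; first by rewrite big_ord0.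
  rewrite big_ord_recl expr1.
  under eq_bigr do rewrite lift0 exprS of_realM -scalerA.
  rewrite -scaler_sumr; apply: Aconv; [exact: Ay|exact: (IH (fun i => y i.+1))|].
  rewrite -!absRE !absR_of_real -of_realD -of_real1 ler_of_real ger0_norm ?invr_ge0//.
  by rewrite (_ : 2^-1 + 2^-1 = 1 :> R)//; field.
(* The factor r i brings the i-th component into A, and the power of 2 pays for its geometric
   coefficient. *)
pose w i := 2 ^+ i.+1 * r i.
have Ww : all_weights w.
  by move=> i; rewrite mulr_ge0 ?exprn_ge0// ltW//; case: (rP i).
apply/nbhs_koethe; exists w, 1; split => // x; rewrite koethe_normB// subr0 => x1.
have [N xN] := all_weights_finite x; rewrite (all_weights_expansion xN).
pose y i := of_real (2 ^+ i.+1) * coord x i *: u i.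
rewrite (_ : \sum_(i < N) _ = \sum_(i < N) of_real (2^-1 ^+ i.+1) *: y i); last first.
  apply: eq_bigr => i _; rewrite /y scalerA mulrA -of_realM -exprMn mulVf ?expr1n//.
  by rewrite of_real1 mul1r.
apply: geomA => i; rewrite /y -[_ * _]invrK; have [ri0 riA] := rP i.
have [c0|c0] := eqVneq (of_real (2 ^+ i.+1) * coord x i) 0.
  by rewrite c0 invr0 invr0 scale0r.
have c1 : 0 < absR (of_real (2 ^+ i.+1) * coord x i) by rewrite absR_gt0.
apply: riA; rewrite absRV -[leLHS]invrK lef_pV2 ?posrE ?invr_gt0//.
rewrite -[leRHS]mul1r ler_pdivlMr// absRM absR_of_real ger0_norm ?exprn_ge0//.
rewrite mulrAC; apply: ltW; apply: le_lt_trans x1; exact: (koethe_norm_ge x i Ww).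
Qed.

End AllWeights.

(** * Increasing sequences of weights, giving barrelled spaces by the Baire argument *)

Section SequenceWeights.
Context (R : realType) (v : nat -> nat -> R).
Hypothesis v_ge0 : forall j n, 0 <= v j n.
Hypothesis v_mono : forall i j n, (i <= j)%N -> v i n <= v j n.
Hypothesis v_gt0 : forall n, 0 < v n n.

Fact seq_weights_ge0 w : range v w -> forall n, 0 <= w n.
Proof. by move=> [j _ <-]. Qed.

Fact seq_weights_directed u w : range v u -> range v w ->
  exists z, [/\ range v z, forall n, u n <= z n & forall n, w n <= z n].
Proof.
move=> [i _ <-] [j _ <-]; exists (v (maxn i j)); split; first by exists (maxn i j).
- by move=> n; rewrite v_mono// leq_maxl.
- by move=> n; rewrite v_mono// leq_maxr.
Qed.

Fact seq_weights_gt0 n : exists2 w, range v w & 0 < w n.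
Proof. by exists (v n) => //; exists n. Qed.

Definition seq_weights : weights R :=
  Weights seq_weights_ge0 seq_weights_directed seq_weights_gt0.

Lemma seq_weights_in j : seq_weights (v j).
Proof. by exists j. Qed.

Lemma seq_weights_barrelled k : barrelled (koethe_lcs k seq_weights).
Proof.
apply: (koethe_barrelled_seq seq_weights_in) => //.
by move=> _ [j _ <-]; exists j.
Qed.

End SequenceWeights.

(** * The counterexamples *)

Lemma cvg_expRN (R : realType) (c : R) : 0 < c ->
  expR (- (c * t)) @[t --> +oo] --> (0 : R).
Proof.
move=> c0; apply: (cvg_comp (fun t => c * t) (fun t => expR (- t)) _ (@cvgr_expR R)).
by apply: gt0_cvgMry => //; exact: cvg_id.
Qed.

(** * Decay criteria for diagonal semigroups *)

Section DiagonalDecay.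
Context (R : realType) (k : scalar_kind) (W : weights R) (l : nat -> R).
Hypothesis l01 : forall n, 0 <= l n <= 1.
Local Notation X := (koethe_lcs k W).
Local Notation T := (diag (k := k) (W := W) l).
Local Notation exp_scaled c := (scale_family (X := X) (fun s => expR (c * s)) T).

Lemma diag_weighted w (c t : R) x n : 0 <= t ->
  w n * absR (coord (exp_scaled c t x) n) = expR (- ((l n - c) * t)) * (w n * absR (coord x n)).
Proof.
move=> t0; rewrite /scale_family coordZ diag_coord// !absRM !absR_of_real.
rewrite !ger0_norm ?expR_ge0// [expR _ * (_ * _)]mulrA -expRD mulrCA; congr (expR _ * _); ring.
Qed.

(** Only coordinates seen by both w and x count. Half of their rate compensates the factor exp(ct),
    the other half remains as decay. *)
Lemma diag_exp_decay w (c : R) x t : W w -> 0 <= t ->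
  (forall n, w n * absR (coord x n) != 0 -> c *+ 2 <= l n) ->
  koethe_norm w (exp_scaled c t x) <= expR (- (c * t)) * koethe_norm w x.
Proof.
move=> Ww t0 cl; apply: koethe_norm_le => n; rewrite diag_weighted//.
have [->|/cl cn] := eqVneq (w n * absR (coord x n)) 0.
  by rewrite mulr0 mulr_ge0 ?expR_ge0 ?koethe_norm_ge0.
rewrite ler_pM ?expR_ge0 ?mulr_ge0 ?absR_ge0 ?(weight_ge0 Ww)//; last exact: koethe_norm_ge.
by rewrite ler_expR lerN2 ler_wpM2r// lerBrDr -mulr2n.
Qed.

(** The n-th coordinate of the rescaled orbit never drops below its initial modulus, since its net
    rate l n - c is nonpositive. *)
Lemma diag_not_exp_decay w (c : R) x n : W w -> 0 < w n -> coord x n != 0 -> l n <= c ->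
  ~ (koethe_norm w (exp_scaled c t x) @[t --> +oo] --> (0 : R)).
Proof.
move=> Ww wn xn lc.
have b0 : 0 < w n * absR (coord x n).
  by rewrite mulr_gt0// absR_gt0.
move=> /cvgrPdist_lt/(_ _ b0)[N [_ NT]].
have /NT : N < `|N| + 1 by rewrite (le_lt_trans (ler_norm N))// ltrDl.
rewrite sub0r normrN ger0_norm ?koethe_norm_ge0//; apply/negP; rewrite -leNgt.
apply: le_trans (koethe_norm_ge _ n Ww); rewrite diag_weighted ?addr_ge0//.
by rewrite ler_peMl ?(ltW b0)// -expR0 ler_expR oppr_ge0 mulr_le0_ge0 ?subr_le0 ?addr_ge0.
Qed.

Hypothesis l_gt0 : forall n, 0 < l n.
Hypothesis l_anti : forall m n, (m <= n)%N -> l n <= l m.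

(** Coordinates from N on are uniformly small on B at all times; the finitely many others decay at
    rate at least l N, as the rates decrease. *)
Lemma diag_uniform_cvg w (B : set X) : W w ->
  (exists C : R, forall x, B x -> koethe_norm w x <= C) ->
  (forall e : R, 0 < e -> exists N, forall x n, B x -> (N <= n)%N ->
     w n * absR (coord x n) <= e) ->
  op_seminorm (koethe_norm w) B (T t) @[t --> +oo] --> (0 : R).
Proof.
move=> Ww [C BC] Btail; apply/cvgrPdist_le => e e0; have [N BN] := Btail _ e0.
have C1 : 0 < `|C| + 1 by rewrite ltr_wpDl.
have /cvgrPdist_le/(_ _ (divr_gt0 e0 C1)) lN := cvg_expRN (l_gt0 N).
near=> t; rewrite sub0r normrN ger0_norm; last first.
  by apply: op_seminorm_ge0 => x; exact: koethe_norm_ge0.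
have t0 : 0 <= t by near: t; exact: nbhs_pinfty_ge.
apply: op_seminorm_le => [|x Bx]; first exact: ltW.
apply: koethe_norm_le => n.
rewrite diag_coord// absRM absR_of_real ger0_norm ?expR_ge0// mulrCA.
have wx0 : 0 <= w n * absR (coord x n) by rewrite mulr_ge0 ?absR_ge0 ?(weight_ge0 Ww).
have [Nn|nN] := leqP N n.
  apply: le_trans (BN _ _ Bx Nn); rewrite ler_piMl// -expR0 ler_expR oppr_le0.
  by rewrite mulr_ge0// ltW.
apply: (@le_trans _ _ (e / (`|C| + 1) * (`|C| + 1))); last by rewrite divfK// gt_eqF.
apply: ler_pM; rewrite ?expR_ge0//.
  apply: (@le_trans _ _ (expR (- (l N * t)))).
    by rewrite ler_expR lerN2 ler_wpM2r// l_anti// ltnW.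
  by rewrite -[leLHS]ger0_norm ?expR_ge0// -normrN -sub0r; near: t.
apply: le_trans (koethe_norm_ge _ n Ww) _; apply: le_trans (BC _ Bx) _.
by apply: le_trans (ler_norm C) _; rewrite lerDl.
Unshelve. all: by end_near. Qed.

End DiagonalDecay.

(** * The two sequences of decay rates *)

Section Rates.
Context (R : realType).

Definition harmonic_rate (n : nat) : R := n.+1%:R^-1.

Lemma harmonic_rate_gt0 n : 0 < harmonic_rate n.
Proof. by rewrite invr_gt0 ltr0n. Qed.

Lemma harmonic_rate01 n : 0 <= harmonic_rate n <= 1.
Proof. by rewrite ltW ?harmonic_rate_gt0//= invf_le1 ?ltr0n// ler1n. Qed.

Lemma harmonic_rate_anti m n : (m <= n)%N -> harmonic_rate n <= harmonic_rate m.
Proof. by move=> mn; rewrite lef_pV2 ?posrE ?ltr0n// ler_nat. Qed.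

Lemma harmonic_rate_small (c : R) : 0 < c -> exists n, harmonic_rate n <= c.
Proof.
move=> c0; exists (Num.bound c^-1); rewrite -[leRHS]invrK lef_pV2 ?posrE ?invr_gt0 ?ltr0n//.
apply: le_trans (ltW (archi_boundP _)) _; first by rewrite invr_ge0 ltW.
by rewrite ler_nat.
Qed.

Definition exponential_rate (n : nat) : R := expR (- n%:R).

Lemma exponential_rate_gt0 n : 0 < exponential_rate n.
Proof. exact: expR_gt0. Qed.

Lemma exponential_rate01 n : 0 <= exponential_rate n <= 1.
Proof. by rewrite expR_ge0/= -expR0 ler_expR oppr_le0. Qed.

Lemma exponential_rate_anti m n : (m <= n)%N -> exponential_rate n <= exponential_rate m.
Proof. by move=> mn; rewrite ler_expR lerN2 ler_nat. Qed.

End Rates.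

(** * The product: pseudo uniform without strong exponential stability *)

Section InitialWeights.
Context (R : realType) (k : scalar_kind).

(* The Koethe space is the full product, with coordinatewise convergence. *)
Definition initial_weight (j n : nat) : R := (n <= j)%:R.

Fact initial_weight_ge0 j n : 0 <= initial_weight j n.
Proof. exact: ler0n. Qed.

Fact initial_weight_mono i j n : (i <= j)%N -> initial_weight i n <= initial_weight j n.
Proof.
move=> ij; rewrite /initial_weight ler_nat; case: (leqP n i) => // ni.
by rewrite (leq_trans ni ij).
Qed.

Fact initial_weight_gt0 n : 0 < initial_weight n n.
Proof. by rewrite /initial_weight leqnn. Qed.

Definition product_weights :=
  seq_weights initial_weight_ge0 initial_weight_mono initial_weight_gt0.
Local Notation X := (koethe_lcs k product_weights).
Local Notation T := (diag (k := k) (W := product_weights) (@harmonic_rate R)).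

Lemma product_admissible : admissible (X := X) T.
Proof. exact/(diag_admissible (@harmonic_rate01 R))/seq_weights_barrelled. Qed.

Lemma product_pseudo_uniformly_exponentially_stable :
  pseudo_uniformly_exponentially_stable X T.
Proof.
move=> _ [_ [j _ <-] ->]; have Wj := seq_weights_in initial_weight_ge0
  initial_weight_mono initial_weight_gt0 j.
(* Half of the smallest rate among the coordinates 0, ..., j that the weight sees. *)
exists (harmonic_rate R j / 2); first by rewrite divr_gt0 ?harmonic_rate_gt0.
move=> B Bb.
have [C C0 BC] := bounded_seminorm Bb (koethe_norm_seminorm k Wj)
  (@koethe_norm_continuous _ k _ _ Wj).
apply: (op_seminorm_cvg0 (f := fun t => expR (- (harmonic_rate R j / 2 * t)) * C)).
- by move=> x; exact: koethe_norm_ge0.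
- rewrite -(mul0r C); apply: cvgM; last exact: cvg_cst.
  by apply: cvg_expRN; rewrite divr_gt0 ?harmonic_rate_gt0.
- near=> t => x Bx; have t0 : 0 <= t by near: t; exact: nbhs_pinfty_ge.
  apply: le_trans (diag_exp_decay (@harmonic_rate01 R) Wj t0 _) _.
    move=> n; rewrite /initial_weight; have [nj _|] := leqP n j.
      by rewrite mulr2n -splitr harmonic_rate_anti.
    by rewrite mul0r eqxx.
  by rewrite ler_wpM2l ?expR_ge0// BC.
Unshelve. all: by end_near. Qed.

Lemma product_not_strongly_exponentially_stable : ~ strongly_exponentially_stable X T.
Proof.
(* The constant sequence belongs to the product and meets arbitrarily small rates. *)
move=> /(_ (koethe_of product_weights (fun=> 1)))[c c0 Tc].
have [n nc] := harmonic_rate_small c0.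
have Wn := seq_weights_in initial_weight_ge0 initial_weight_mono initial_weight_gt0 n.
apply: (diag_not_exp_decay (@harmonic_rate01 R) Wn (initial_weight_gt0 n) _ nc).
  2: exact: cvg_Gamma0 (koethe_norm_Gamma k Wn) Tc.
rewrite koethe_ofE ?oner_eq0// => w [j _ <-] e e0; exists j.+1 => m jm.
by rewrite /initial_weight leqNgt jm mul0r ltW.
Qed.

End InitialWeights.

(** * The direct sum: strong without pseudo uniform exponential stability *)

Section DirectSum.
Context (R : realType) (k : scalar_kind).
Local Notation W := (all_weights R).
Local Notation X := (koethe_lcs k W).
Local Notation T := (diag (k := k) (W := W) (@harmonic_rate R)).

Lemma direct_sum_admissible : admissible (X := X) T.
Proof. exact/(diag_admissible (@harmonic_rate01 R))/all_weights_barrelled. Qed.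

Lemma direct_sum_strongly_exponentially_stable : strongly_exponentially_stable X T.
Proof.
move=> x; have [N xN] := all_weights_finite x.
have c0 : 0 < harmonic_rate R N / 2 by rewrite divr_gt0 ?harmonic_rate_gt0.
exists (harmonic_rate R N / 2) => //; apply: cvg0_Gamma => _ [w Ww ->].
have f0 : expR (- (harmonic_rate R N / 2 * t)) * koethe_norm w x @[t --> +oo] --> (0 : R).
  by rewrite -(mul0r (koethe_norm w x)); apply: cvgM; [exact: cvg_expRN|exact: cvg_cst].
under eq_cvg do rewrite -op_seminorm1.
apply: (op_seminorm_cvg0 _ f0) => [y|]; first exact: koethe_norm_ge0.
near=> t => _ ->; have t0 : 0 <= t by near: t; exact: nbhs_pinfty_ge.
apply: diag_exp_decay => // [|n]; first exact: harmonic_rate01.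
have [Nn|nN _] := leqP N n; first by rewrite xN// absR0 mulr0 eqxx.
by rewrite mulr2n -splitr harmonic_rate_anti// ltnW.
Unshelve. all: by end_near. Qed.

Lemma direct_sum_not_pseudo_uniformly_exponentially_stable :
  ~ pseudo_uniformly_exponentially_stable X T.
Proof.
(* The constant weight sees all coordinates; for any proposed c, one unit vector of rate at most c
   is already a bounded set that refutes it. *)
have W1 : W (fun=> 1) by move=> n.
move=> /(_ _ (koethe_norm_Gamma k W1))[c c0 Tc].
have [n nc] := harmonic_rate_small c0.
have := Tc [set unit_vec k W n] (tvs_bounded1 _).
under eq_cvg do rewrite op_seminorm1.
apply: (diag_not_exp_decay (@harmonic_rate01 R) W1 ltr01 _ nc).
by rewrite coord_unit eqxx oner_eq0.
Qed.

End DirectSum.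

(** * Rapidly decreasing sequences: polynomial and logarithmic decay *)

Section RapidlyDecreasing.
Context (R : realType) (k : scalar_kind).

Definition power_weight (j n : nat) : R := n.+1%:R ^+ j.

Fact power_weight_ge0 j n : 0 <= power_weight j n.
Proof. by rewrite exprn_ge0. Qed.

Fact power_weight_mono i j n : (i <= j)%N -> power_weight i n <= power_weight j n.
Proof. by move=> ij; rewrite ler_weXn2l// ler1n. Qed.

Fact power_weight_gt0 n : 0 < power_weight n n.
Proof. by rewrite exprn_gt0. Qed.

Definition power_weights :=
  seq_weights power_weight_ge0 power_weight_mono power_weight_gt0.
Local Notation X := (koethe_lcs k power_weights).

Fact power_weights_in j : power_weights (power_weight j).
Proof. exact: seq_weights_in. Qed.

(** A test vector without zero coordinates, so that it meets every rate. *)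
Definition exp_seq : X := koethe_of power_weights (fun n => of_real (expR (- n%:R))).

Lemma coord_exp_seq n : coord exp_seq n = of_real (expR (- n%:R)).
Proof.
rewrite koethe_ofE// => _ [j _ <-] e e0.
(* The exponent j + 1 leaves a factor m + 1 to spare, which forces the terms to 0; [expR 1] comes
   from passing from m to m + 1. *)
have [C C0 CE] := expR_ge_exprn j.+1 (@ltr01 R).
exists (Num.bound (C * expR 1 / e)) => m Nm; rewrite absR_of_real ger0_norm ?expR_ge0//.
have m0 : 0 < m.+1%:R :> R by rewrite ltr0n.
rewrite -(ler_pM2l m0) mulrA -exprS.
apply: (@le_trans _ _ (C * expR 1)).
  rewrite expRN ler_pdivrMr ?expR_gt0// -mulrA -expRD.
  by have := CE m.+1%:R (ltW m0); rewrite mul1r -nat1r.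
rewrite -ler_pdivrMr//; apply: le_trans (ltW (archi_boundP _)) _.
  by rewrite divr_ge0 ?mulr_ge0 ?expR_ge0 ?(ltW C0) ?(ltW e0).
by rewrite ler_nat leqW.
Qed.

Local Notation T l := (diag (k := k) (W := power_weights) l).

Lemma rapid_admissible l : (forall n, 0 <= l n <= 1) -> admissible (X := X) (T l).
Proof. by move=> l01; apply/(diag_admissible l01)/seq_weights_barrelled. Qed.

Lemma rapid_super_polynomially_stable :
  super_polynomially_stable X (T (@harmonic_rate R)).
Proof.
move=> alpha B _ alpha1 Bb [_ [j _ <-] ->].
have [m alpham] : exists m, alpha + 1 <= m%:R.
  exists (Num.bound (alpha + 1)); apply: ltW; apply: archi_boundP.
  by rewrite addr_ge0// ltW// (lt_trans ltr01).
have Wjm := power_weights_in (j + m).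
have [C C0 BC] := bounded_seminorm Bb (koethe_norm_seminorm k Wjm)
  (@koethe_norm_continuous _ k _ _ Wjm).
have [D D0 DE] := expR_ge_exprn m (@ltr01 R).
(* With s = t / (n + 1), t^m is s^m (n + 1)^m: the exponential exp(-s) absorbs s^m up to the
   constant D, and (n + 1)^m raises the weight from j to j + m. *)
have decay t x : 0 < t -> t ^+ m * koethe_norm (power_weight j) (T (@harmonic_rate R) t x) <=
    D * koethe_norm (power_weight (j + m)) x.
  move=> t0; have tm0 : 0 < t ^+ m by exact: exprn_gt0.
  rewrite -ler_pdivlMl//; apply: koethe_norm_le => n; rewrite ler_pdivlMl//.
  rewrite diag_coord ?(ltW t0)//; last exact: harmonic_rate01.
  rewrite absRM absR_of_real ger0_norm ?expR_ge0//.
  pose s := harmonic_rate R n * t.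
  have s0 : 0 <= s by rewrite mulr_ge0 ?ltW ?harmonic_rate_gt0.
  have -> : t ^+ m = s ^+ m * n.+1%:R ^+ m by rewrite -exprMn /s mulrAC mulVf ?mul1r.
  rewrite [leLHS](_ : _ = (s ^+ m * expR (- s)) *
    (power_weight (j + m) n * absR (coord x n))); last first.
    rewrite /power_weight exprD -/s; move: (s ^+ m) (n.+1%:R ^+ m) (n.+1%:R ^+ j) (expR _) => *.
    by ring.
  apply: ler_pM; rewrite ?mulr_ge0 ?expR_ge0 ?exprn_ge0 ?absR_ge0//.
    by rewrite expRN ler_pdivrMr ?expR_gt0//; have := DE _ s0; rewrite mul1r.
  exact: koethe_norm_ge.
apply: (op_seminorm_cvg0 (f := fun t => D * C * t^-1)).
- by move=> x; apply: koethe_norm_ge0; exact: power_weights_in.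
- rewrite -(mulr0 (D * C)); apply: cvgM; first exact: cvg_cst.
  by apply/(gtr0_cvgV0 (nbhs_pinfty_gt (num_real 0))); exact: cvg_id.
- near=> t => x Bx; have t1 : 1 <= t by near: t; exact: nbhs_pinfty_ge.
  have t0 : 0 < t by exact: lt_le_trans t1.
  have Gj := koethe_norm_Gamma k (power_weights_in j).
  rewrite (scale_family_seminorm _ _ _ _ (Gamma_seminorm Gj)) ger0_norm ?powR_ge0//.
  rewrite ler_pdivlMr// mulrC mulrA.
  apply: le_trans (ler_wpM2r _ (mulr_powR_le t1 alpham)) _.
    by apply: koethe_norm_ge0; exact: power_weights_in.
  by apply: le_trans (decay _ _ t0) _; rewrite ler_wpM2l ?(ltW D0)// BC.
Unshelve. all: by end_near. Qed.

Lemma rapid_not_pseudo_strongly_exponentially_stable :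
  ~ pseudo_strongly_exponentially_stable X (T (@harmonic_rate R)).
Proof.
have W0 := power_weights_in 0.
move=> /(_ _ exp_seq (koethe_norm_Gamma k W0))[c c0 Tc].
have [n nc] := harmonic_rate_small c0.
apply: (diag_not_exp_decay (@harmonic_rate01 R) W0 _ _ nc Tc).
  by rewrite exprn_gt0.
by rewrite coord_exp_seq of_real_eq0 gt_eqF ?expR_gt0.
Qed.

Lemma rapid_uniformly_stable : uniformly_stable X (T (@exponential_rate R)).
Proof.
move=> B _ Bb [_ [j _ <-] ->].
(* Boundedness for the next weight makes the n-th term for weight j at most C / (n + 1) on B, a
   uniform tail estimate. *)
have [C C0 BC] : exists2 C : R, 0 <= C & forall x, B x -> koethe_norm (power_weight j.+1) x <= C.
  have Wj := power_weights_in j.+1.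
  exact: bounded_seminorm Bb (koethe_norm_seminorm k Wj) (@koethe_norm_continuous _ k _ _ Wj).
apply: (diag_uniform_cvg (@exponential_rate01 R) (@exponential_rate_gt0 R)
  (@exponential_rate_anti R) (power_weights_in j)).
  exists C => x /BC; apply: le_trans.
  by apply: koethe_norm_mono => [||n]; rewrite ?power_weight_mono//; exact: power_weights_in.
move=> e e0; exists (Num.bound (C / e)) => x n Bx Nn.
have n0 : 0 < n.+1%:R :> R by rewrite ltr0n.
rewrite -(ler_pM2l n0) mulrA -exprS.
apply: le_trans (koethe_norm_ge _ n (power_weights_in j.+1)) _.
apply: le_trans (BC _ Bx) _; rewrite -ler_pdivrMr//.
apply: le_trans (ltW (archi_boundP _)) _; first by rewrite divr_ge0// ltW.
by rewrite ler_nat leqW.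
Qed.

(* At time e^n the n-th coordinate of t^2 T(t) (e^-m)_m is e^(n-1). *)
Lemma rapid_not_super_polynomially_stable :
  ~ super_polynomially_stable X (T (@exponential_rate R)).
Proof.
have W0 := power_weights_in 0.
move=> /(_ _ _ _ (ltr1n R 2) (tvs_bounded1 exp_seq) (koethe_norm_Gamma k W0)).
under eq_cvg do rewrite op_seminorm1.
(* The threshold exp(-1) is at most exp(n - 1) for every n, so it is violated at the time exp(n) >
   M. *)
move=> /cvgrPdist_lt/(_ _ (expR_gt0 (- 1)))[M [_ MT]].
pose n := Num.bound `|M|; pose t : R := expR n%:R.
have Mt : M < t.
  apply: le_lt_trans (ler_norm M) _; apply: lt_le_trans (archi_boundP _) _ => //.
  by apply: le_trans (expR_ge1Dx _); rewrite lerDr.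
have t0 : 0 <= t by exact: expR_ge0.
have /= := MT _ Mt; rewrite sub0r normrN ger0_norm; last exact: koethe_norm_ge0.
apply/negP; rewrite -leNgt.
have Gw := koethe_norm_Gamma k W0.
rewrite (scale_family_seminorm _ _ _ _ (Gamma_seminorm Gw)).
apply: le_trans (ler_wpM2l _ (koethe_norm_ge _ n W0)) => //.
rewrite diag_coord//; last exact: exponential_rate01.
rewrite coord_exp_seq absRM !absR_of_real !ger0_norm ?expR_ge0 ?powR_ge0//.
have -> : exponential_rate R n * t = 1 by rewrite -expRD addNr expR0.
rewrite powR_mulrn// /power_weight expr0 mul1r -expRM_natl -!expRD ler_expR.
by rewrite mulr_natl mulr2n addrCA addrK lerDl.
Qed.

End RapidlyDecreasing.

(** * The space c_0: strong without uniform stability *)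

Section NullSequences.
Context (R : realType) (k : scalar_kind).

Definition const_weights : weights R :=
  @seq_weights R (fun _ _ => 1) (fun _ _ => ler01) (fun _ _ _ _ => lexx _) (fun=> ltr01).
Local Notation X := (koethe_lcs k const_weights).
Local Notation T := (diag (k := k) (W := const_weights) (@harmonic_rate R)).

Lemma null_sequences_admissible : admissible (X := X) T.
Proof. exact/(diag_admissible (@harmonic_rate01 R))/seq_weights_barrelled. Qed.

Lemma null_sequences_strongly_stable : strongly_stable X T.
Proof.
move=> x; apply: cvg0_Gamma => _ [w Ww ->].
under eq_cvg do rewrite -op_seminorm1.
apply: (diag_uniform_cvg (@harmonic_rate01 R) (@harmonic_rate_gt0 R)
  (@harmonic_rate_anti R) Ww).
  by exists (koethe_norm w x) => _ ->.
by move=> e e0; have [N xN] := coord_null x Ww e0; exists N => _ n -> /xN.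
Qed.

Lemma null_sequences_not_uniformly_stable : ~ uniformly_stable X T.
Proof.
have W1 : const_weights (fun=> 1) by exists 0%N.
pose B : set X := range (unit_vec k const_weights).
have B1 w x : const_weights w -> B x -> koethe_norm w x <= 1.
  move=> [j _ <-] [n _ <-]; apply: koethe_norm_le => m; rewrite coord_unit mul1r.
  by case: eqP => _; rewrite ?absR1 ?absR0.
have Bb : tvs_bounded B.
  by apply: koethe_bounded => w Ww; exists 1 => x; exact: B1.
move=> /(_ _ _ Bb (koethe_norm_Gamma k W1)).
move=> /cvgrPdist_lt/(_ _ (expR_gt0 (- 1)))[M [_ MT]].
pose t := `|M| + 1; have t0 : 0 < t by rewrite ltr_wpDl.
have Mt : M < t by rewrite (le_lt_trans (ler_norm M))// ltrDl.
have /= := MT _ Mt; rewrite sub0r normrN ger0_norm; last first.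
  by apply: op_seminorm_ge0 => x; exact: koethe_norm_ge0.
apply/negP; rewrite -leNgt.
(* At any time t some unit vector has rate at most 1 / t, so its orbit still has norm at least
   exp(-1). *)
have [n nt] : exists n, harmonic_rate R n <= t^-1 by apply: harmonic_rate_small; rewrite invr_gt0.
have Bn : B (unit_vec k const_weights n) by exists n.
apply: le_trans (op_seminorm_ge (c := 1) _ Bn); last first.
  move=> x Bx; apply: le_trans (B1 _ _ W1 Bx).
  by apply: diag_norm_le => //; [exact: harmonic_rate01|exact: ltW].
apply: le_trans (koethe_norm_ge _ n W1).
rewrite mul1r diag_coord ?(ltW t0)//; last exact: harmonic_rate01.
rewrite coord_unit eqxx mulr1 absR_of_real ger0_norm ?expR_ge0// ler_expR lerN2.
by rewrite -ler_pdivlMr// mul1r.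
Qed.

End NullSequences.

Theorem theorem2p3 (R : realType) (k : scalar_kind) :
  (forall (X : lcs R k) (T : R -> X -> X),
     mackey_complete X -> barrelled X ->
     C0_semigroup T -> exponentially_bounded T ->
     (uniformly_exponentially_stable X T ->
        pseudo_uniformly_exponentially_stable X T) /\
     (uniformly_exponentially_stable X T ->
        strongly_exponentially_stable X T) /\
     (pseudo_uniformly_exponentially_stable X T ->
        pseudo_strongly_exponentially_stable X T) /\
     (strongly_exponentially_stable X T ->
        pseudo_strongly_exponentially_stable X T) /\
     (pseudo_strongly_exponentially_stable X T ->
        super_polynomially_stable X T) /\
     (super_polynomially_stable X T ->
        uniformly_stable X T) /\
     (uniformly_stable X T ->
        strongly_stable X T)) /\
  (realised_without R k
      pseudo_uniformly_exponentially_stable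
      uniformly_exponentially_stable /\
   realised_without R k
      strongly_exponentially_stable
      uniformly_exponentially_stable /\
   realised_without R k
      pseudo_strongly_exponentially_stable
      pseudo_uniformly_exponentially_stable /\
   realised_without R k
      pseudo_strongly_exponentially_stable
      strongly_exponentially_stable /\
   realised_without R k
      super_polynomially_stable
      pseudo_strongly_exponentially_stable /\
   realised_without R k
      uniformly_stable
      super_polynomially_stable /\
   realised_without R k
      strongly_stable
      uniformly_stable) /\
  (realised_without R k
      pseudo_uniformly_exponentially_stable
      strongly_exponentially_stable /\
   realised_without R k
      strongly_exponentially_stable
      pseudo_uniformly_exponentially_stable).
Proof.
have Pa := product_admissible R k.
have Ppue := @product_pseudo_uniformly_exponentially_stable R k.
have Pnse := @product_not_strongly_exponentially_stable R k.
have Sa := direct_sum_admissible R k.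
have Sse := @direct_sum_strongly_exponentially_stable R k.
have Snpue := @direct_sum_not_pseudo_uniformly_exponentially_stable R k.
split; [move=> X T _ bX CT expT|split].
- split; first exact: uniformly_exponentially_stable_pseudo.
  split; first exact: uniformly_exponentially_stable_strong.
  split; first exact: pseudo_uniformly_exponentially_stable_strong.
  split; first exact: strongly_exponentially_stable_pseudo.
  split; first exact: pseudo_strongly_exponentially_stable_super_polynomial.
  split; first exact: super_polynomially_stable_uniform.
  exact: uniformly_stable_strong.
(* The product and the direct sum settle (a) to (d): each has one of the two incomparable properties
   and lacks the other, hence lacks uniform exponential stability while having the pseudo strong
   one. *)
- split; first by do 2 eexists; split; [exact: Pa|exact: Ppue
    |move=> /uniformly_exponentially_stable_strong; exact: Pnse].
  split; first by do 2 eexists; split; [exact: Sa|exact: Sse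
    |move=> /uniformly_exponentially_stable_pseudo; exact: Snpue].
  split; first by do 2 eexists; split; [exact: Sa
    |exact: strongly_exponentially_stable_pseudo Sse|exact: Snpue].
  split; first by do 2 eexists; split; [exact: Pa
    |exact: pseudo_uniformly_exponentially_stable_strong Ppue|exact: Pnse].
  split.
    do 2 eexists; split; [exact: (rapid_admissible k (@harmonic_rate01 R))
      |exact: rapid_super_polynomially_stable
      |exact: rapid_not_pseudo_strongly_exponentially_stable].
  split.
    do 2 eexists; split; [exact: (rapid_admissible k (@exponential_rate01 R))
      |exact: rapid_uniformly_stable|exact: rapid_not_super_polynomially_stable].
  do 2 eexists; split; [exact: null_sequences_admissible
    |exact: null_sequences_strongly_stable|exact: null_sequences_not_uniformly_stable].
- split; first by do 2 eexists; split; [exact: Pa|exact: Ppue|exact: Pnse].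
  by do 2 eexists; split; [exact: Sa|exact: Sse|exact: Snpue].
Qed.
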